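(* Let $a,b\ge1$ be integers, $\alpha,\beta\in[0,1)$, and set $\Delta a=\lfloor\beta/(1-\alpha)\rfloor$, $\Delta b=\lfloor\alpha/(1-\beta)\rfloor$. If $b\le\Delta b$ or $a\le\Delta a$, then $I(\alpha,\beta,R_{a,b})=0$. Suppose $b>\Delta b$ and $a>\Delta a$. If $\beta\le\alpha$ and $\lfloor\alpha/(1-\beta)\rfloor(1-\beta)\le\beta$, then $$I(\alpha,\beta,R_{a,b})=(1-\alpha)ab+((\alpha-\beta)\Delta b-\beta)a-\beta b-(1-\beta)\Delta a\Delta b+\beta\Delta a+\beta\Delta b+\beta-\max\{(1-\beta)\Delta b,(1-\alpha)\Delta a\}.$$ If $\beta\le\alpha$ and $\lfloor\alpha/(1-\beta)\rfloor(1-\beta)>\beta$, then $$I(\alpha,\beta,R_{a,b})=(1-\alpha)ab+\alpha\Delta b\,a-\beta b+\beta\Delta b+\min\{-\beta(\Delta b+1)a-(1-\beta)\Delta a\Delta b+\beta\Delta a+\beta-(1-\alpha)\Delta a,\ -\Delta b\,a\}.$$ If $\beta\ge\alpha$, then $I(\alpha,\beta,R_{a,b})=I(\beta,\alpha,R_{b,a})$.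
   Context: $\mathbb Z_+=\{0,1,2,\dots\}$, $R_{a,b}=([0,a-1]\times[0,b-1])\cap\mathbb Z_+^2$. For a zero-set $\mathcal Z$ (here $\mathcal Z=R_{a,b}$), $\mathrm{row}(x,A),\mathrm{col}(x,A)$ count points of $A$ on the horizontal/vertical line through $x$, $\mathcal T(A)=A\cup\{x\notin A:(\mathrm{row}(x,A),\mathrm{col}(x,A))\notin\mathcal Z\}$, and $A$ spans if $\bigcup_t\mathcal T^t(A)=\mathbb Z_+^2$. Large deviation rate: as $p\to0$ let integers $N,M\to\infty$ with $\log N\sim-\alpha\log p$, $\log M\sim-\beta\log p$; the initial set contains each point of $R_{N,M}$ independently with probability $p$; $I(\alpha,\beta,\mathcal Z)=\lim_{p\to0}\log P_p(\text{initial set spans})/\log p$. *)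

(* Defs.v *)
From Stdlib Require Import Reals Lra List Classical ClassicalEpsilon.
Import ListNotations.
Open Scope R_scope.

Definition pset := nat * nat -> Prop.

(* "P holds for at least k distinct naturals" (counts may be infinite). *)
Definition atleast (k : nat) (P : nat -> Prop) : Prop :=
  exists l : list nat, NoDup l /\ length l = k /\ Forall P l.

(* Bootstrap operator T for the zero-set Z = R_{a,b}:
   x = (x1,x2) not in A is added iff (row(x,A), col(x,A)) is not in R_{a,b},
   i.e. row(x,A) >= a or col(x,A) >= b.  The row of x is the horizontal line
   {(i, x2)}, the column of x is the vertical line {(x1, j)}. *)
Definition Tstep (a b : nat) (A : pset) : pset :=
  fun x => A x \/
    (~ A x /\ (atleast a (fun i => A (i, snd x)) \/
               atleast b (fun j => A (fst x, j)))).

Fixpoint Titer (a b : nat) (t : nat) (A : pset) : pset :=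
  match t with
  | O => A
  | S t' => Tstep a b (Titer a b t' A)
  end.

Definition spans (a b : nat) (A : pset) : Prop :=
  forall x : nat * nat, exists t : nat, Titer a b t A x.

(* Probability that the p-random subset of the cells cs (together with the
   already chosen ones) spans: sum over all subsets S of cs of
   p^|S| (1-p)^(|cs|-|S|) * [chosen ∪ S spans]. *)
Fixpoint span_prob (a b : nat) (p : R) (cs chosen : list (nat * nat)) : R :=
  match cs with
  | nil => if excluded_middle_informative (spans a b (fun x => In x chosen))
           then 1 else 0
  | c :: cs' => p * span_prob a b p cs' (c :: chosen)
                + (1 - p) * span_prob a b p cs' chosen
  end.

Definition P_span (a b N M : nat) (p : R) : R :=
  span_prob a b p (list_prod (seq 0 N) (seq 0 M)) nil.

Definition tends_infty0 (N : R -> nat) : Prop :=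
  forall K : R, exists delta, 0 < delta /\
    forall p, 0 < p < delta -> K <= INR (N p).

Definition lim0 (f : R -> R) (L : R) : Prop :=
  forall eps, 0 < eps -> exists delta, 0 < delta /\
    forall p, 0 < p < delta -> Rabs (f p - L) < eps.

(* I(alpha, beta, R_{a,b}) = v : for every admissible choice of N(p), M(p)
   (log N ~ -alpha log p, log M ~ -beta log p, N, M -> infinity),
   P_p(span) > 0 for small p and  log P_p(span) / log p -> v. *)
Definition has_rate (alpha beta : R) (a b : nat) (v : R) : Prop :=
  forall N M : R -> nat,
    tends_infty0 N -> tends_infty0 M ->
    lim0 (fun p => ln (INR (N p)) / (- ln p)) alpha ->
    lim0 (fun p => ln (INR (M p)) / (- ln p)) beta ->
    (exists delta, 0 < delta /\ forall p, 0 < p < delta ->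
        0 < P_span a b (N p) (M p) p) /\
    lim0 (fun p => ln (P_span a b (N p) (M p) p) / ln p) v.

Definition floorR (x : R) : R := IZR (Int_part x).

(* Main.v *)
(** A line fills up as soon as it has enough points, so spanning amounts to
    filling rows and columns one after the other until [a] columns or [b] rows
    are full.  With [i] full columns, the next row needs [a - i] further points;
    such a row exists with probability [p ^ max(0, (a - i) (1 - alpha) - beta)]
    up to [p ^ o(1)], and symmetrically for columns.  The rate is therefore the
    minimal total cost of a lattice path.  The upper bound on the probability is
    a union bound over paths and over the (disjoint) points used, stopped as soon
    as the remaining steps are free, i.e. at [a - Da] columns or [b - Db] rows;
    the lower bound realises a given path in disjoint strips of the box.
    Exchanging a row step with a neighbouring column step shows that, for
    [beta <= alpha], rows should come first; the costs are then affine in the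
    numbers of rows and columns, which leaves three candidates:
    [b - Db] rows;  [b - Db - 1] rows and then [a - Da] columns;
    [b - Db - 1] rows, [a - Da - 1] columns and then one more row. *)
Require Import Defs.
From Stdlib Require Import Reals ZArith Lra Lia List Permutation Classical ClassicalEpsilon.
From Stdlib Require Import FunctionalExtensionality PropExtensionality.
Import ListNotations.
Open Scope R_scope.

(** * Random subsets of a finite list of cells *)

Notation cell := (nat * nat)%type.

Definition indic (Q : Prop) : R := if excluded_middle_informative Q then 1 else 0.

Definition subset (S T : pset) : Prop := forall x, S x -> T x.

Definition add (c : cell) (S : pset) : pset := fun x => x = c \/ S x.

(** The recursion decides the cells one at a time, as [span_prob] does, but for an arbitrary
    function of the random set; correlation and independence then follow by induction on the
    list. *)
Fixpoint expect (p : R) (cs : list cell) (f : pset -> R) : R :=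
  match cs with
  | nil => f (fun _ => False)
  | c :: cs' => p * expect p cs' (fun S => f (add c S)) + (1 - p) * expect p cs' f
  end.

Definition prob (p : R) (cs : list cell) (E : pset -> Prop) : R :=
  expect p cs (fun S => indic (E S)).

Lemma indic_true (Q : Prop) : Q -> indic Q = 1.
Proof. unfold indic; destruct (excluded_middle_informative Q); tauto. Qed.

Lemma indic_false (Q : Prop) : ~ Q -> indic Q = 0.
Proof. unfold indic; destruct (excluded_middle_informative Q); tauto. Qed.

Lemma indic_bounds (Q : Prop) : 0 <= indic Q <= 1.
Proof. unfold indic; destruct (excluded_middle_informative Q); lra. Qed.

Lemma indic_le (Q Q' : Prop) : (Q -> Q') -> indic Q <= indic Q'.
Proof.
  intros H; unfold indic.
  destruct (excluded_middle_informative Q), (excluded_middle_informative Q'); try lra; tauto.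
Qed.

Lemma indic_iff (Q Q' : Prop) : (Q <-> Q') -> indic Q = indic Q'.
Proof. intros H; apply Rle_antisym; apply indic_le; tauto. Qed.

Lemma indic_and (Q Q' : Prop) : indic (Q /\ Q') = indic Q * indic Q'.
Proof.
  unfold indic.
  destruct (excluded_middle_informative Q), (excluded_middle_informative Q'),
    (excluded_middle_informative (Q /\ Q')); try lra; tauto.
Qed.

Lemma indic_not (Q : Prop) : indic (~ Q) = 1 - indic Q.
Proof.
  unfold indic.
  destruct (excluded_middle_informative Q), (excluded_middle_informative (~ Q)); try lra; tauto.
Qed.

Lemma pset_ext (S T : pset) : (forall x, S x <-> T x) -> S = T.
Proof.
  intros H; apply functional_extensionality; intros x.
  apply propositional_extensionality, H.
Qed.

Lemma expect_le (p : R) (cs : list cell) (f g : pset -> R) :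
  0 <= p <= 1 ->
  (forall S, (forall x, S x -> In x cs) -> f S <= g S) ->
  expect p cs f <= expect p cs g.
Proof.
  intros Hp; revert f g; induction cs as [|c cs IH]; intros f g H; simpl.
  - apply H; tauto.
  - apply Rplus_le_compat; apply Rmult_le_compat_l; try lra; apply IH; intros S HS; apply H.
    + intros x [->|Hx]; [left; reflexivity | right; auto].
    + intros x Hx; right; auto.
Qed.

Lemma expect_const (p : R) (cs : list cell) (k : R) : expect p cs (fun _ => k) = k.
Proof. induction cs as [|c cs IH]; simpl; [reflexivity | rewrite IH; ring]. Qed.

Lemma expect_plus (p : R) (cs : list cell) (f g : pset -> R) :
  expect p cs (fun S => f S + g S) = expect p cs f + expect p cs g.
Proof.
  revert f g; induction cs as [|c cs IH]; intros f g; simpl; [reflexivity|].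
  rewrite (IH (fun S => f (add c S)) (fun S => g (add c S))), IH; ring.
Qed.

Lemma expect_compl (p : R) (cs : list cell) (f : pset -> R) :
  expect p cs (fun S => 1 - f S) = 1 - expect p cs f.
Proof.
  revert f; induction cs as [|c cs IH]; intros f; simpl; [reflexivity|].
  rewrite (IH (fun S => f (add c S))), IH; ring.
Qed.

(** * Positive correlation and independence *)

Definition increasing (f : pset -> R) : Prop := forall S T, subset S T -> f S <= f T.

(** Conditioning on the first cell and using induction on both outcomes leaves a two-point
    inequality. Its two sides differ by [p * (1 - p) * ((f1 - f0) * (g1 - g0))], and both
    differences are nonnegative by monotonicity. *)
Lemma harris (p : R) (cs : list cell) (f g : pset -> R) :
  0 <= p <= 1 -> increasing f -> increasing g ->
  expect p cs f * expect p cs g <= expect p cs (fun S => f S * g S).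
Proof.
  intros Hp; revert f g; induction cs as [|c cs IH]; intros f g Hf Hg; simpl; [lra|].
  assert (Hadd : forall h, increasing h -> increasing (fun S => h (add c S))).
  { intros h Hh S T HST; apply Hh; intros x [->|Hx]; [left; reflexivity | right; auto]. }
  assert (Hup : forall h, increasing h -> expect p cs h <= expect p cs (fun S => h (add c S))).
  { intros h Hh; apply expect_le; auto; intros S _; apply Hh; intros x Hx; right; auto. }
  pose proof (IH _ _ Hf Hg) as I0.
  pose proof (IH _ _ (Hadd f Hf) (Hadd g Hg)) as I1; simpl in I1.
  pose proof (Hup f Hf) as Uf; pose proof (Hup g Hg) as Ug.
  set (f1 := expect p cs (fun S => f (add c S))) in *.
  set (g1 := expect p cs (fun S => g (add c S))) in *.
  set (f0 := expect p cs f) in *; set (g0 := expect p cs g) in *.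
  apply Rle_trans with (p * (f1 * g1) + (1 - p) * (f0 * g0)).
  - assert (0 <= p * (1 - p) * ((f1 - f0) * (g1 - g0))).
    { apply Rmult_le_pos; apply Rmult_le_pos; lra. }
    nra.
  - apply Rplus_le_compat; apply Rmult_le_compat_l; lra.
Qed.

Definition depends_on (U : pset) (f : pset -> R) : Prop :=
  forall S T, (forall x, U x -> (S x <-> T x)) -> f S = f T.

(** Each cell lies outside [U] or outside [V], so deciding it leaves one of the two functions
    unchanged, and that factor can be pulled out. *)
Lemma expect_indep (p : R) (cs : list cell) (U V : pset) (f g : pset -> R) :
  depends_on U f -> depends_on V g -> (forall x, U x -> ~ V x) ->
  expect p cs (fun S => f S * g S) = expect p cs f * expect p cs g.
Proof.
  intros Hf Hg HUV; revert f g Hf Hg; induction cs as [|c cs IH]; intros f g Hf Hg; simpl;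
    [reflexivity|].
  assert (Hadd : forall W h, depends_on W h -> depends_on W (fun S => h (add c S))).
  { intros W h Hh S T HST; apply Hh; intros x Hx; specialize (HST x Hx); unfold add; tauto. }
  assert (Hirr : forall W h, depends_on W h -> ~ W c -> (fun S => h (add c S)) = h).
  { intros W h Hh Hc; apply functional_extensionality; intros S; apply Hh; intros x Hx.
    unfold add; split; [intros [->|]; tauto | tauto]. }
  rewrite (IH _ _ Hf Hg), (IH (fun S => f (add c S)) (fun S => g (add c S)))
    by (apply Hadd; assumption).
  destruct (classic (V c)) as [Hc|Hc].
  - rewrite (Hirr U f Hf) by (intros Hu; exact (HUV c Hu Hc)); ring.
  - rewrite (Hirr V g Hg Hc); ring.
Qed.

(** Transposing a box lists the cells of the transposed box in a different order. *)
Lemma expect_permutation (p : R) (cs cs' : list cell) :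
  Permutation cs cs' -> forall f, expect p cs f = expect p cs' f.
Proof.
  induction 1 as [|c cs cs' _ IH|c d cs|cs1 cs2 cs3 _ IH1 _ IH2]; intros f; simpl.
  - reflexivity.
  - rewrite !IH; reflexivity.
  - replace (fun S : pset => f (add d (add c S))) with (fun S : pset => f (add c (add d S))).
    + ring.
    + apply functional_extensionality; intros S; f_equal; apply pset_ext; intros x.
      unfold add; tauto.
  - rewrite IH1; apply IH2.
Qed.

Definition swap (x : cell) : cell := (snd x, fst x).

Lemma swap_swap (x : cell) : swap (swap x) = x.
Proof. destruct x; reflexivity. Qed.

Lemma expect_swap (p : R) (cs : list cell) (f : pset -> R) :
  expect p (map swap cs) f = expect p cs (fun S => f (fun x => S (swap x))).
Proof.
  revert f; induction cs as [|c cs IH]; intros f; simpl; [reflexivity|].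
  rewrite !IH; do 2 f_equal; f_equal; apply functional_extensionality; intros S.
  f_equal; apply pset_ext; intros [x1 x2]; destruct c as [c1 c2].
  unfold add, swap; simpl; split; intros [H|H]; auto; left; congruence.
Qed.

Lemma prob_le (p : R) (cs : list cell) (E G : pset -> Prop) :
  0 <= p <= 1 -> (forall S, (forall x, S x -> In x cs) -> E S -> G S) ->
  prob p cs E <= prob p cs G.
Proof. intros Hp H; apply expect_le; auto; intros S HS; apply indic_le; auto. Qed.

Lemma prob_nonneg (p : R) (cs : list cell) (E : pset -> Prop) :
  0 <= p <= 1 -> 0 <= prob p cs E.
Proof.
  intros Hp; rewrite <- (expect_const p cs 0); apply expect_le; auto.
  intros S _; apply indic_bounds.
Qed.

Lemma prob_le_1 (p : R) (cs : list cell) (E : pset -> Prop) :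
  0 <= p <= 1 -> prob p cs E <= 1.
Proof.
  intros Hp; rewrite <- (expect_const p cs 1); apply expect_le; auto.
  intros S _; apply indic_bounds.
Qed.

Lemma prob_true (p : R) (cs : list cell) (E : pset -> Prop) :
  (forall S, E S) -> prob p cs E = 1.
Proof.
  intros H; unfold prob; rewrite <- (expect_const p cs 1); f_equal.
  apply functional_extensionality; intros S; apply indic_true, H.
Qed.

Lemma prob_not (p : R) (cs : list cell) (E : pset -> Prop) :
  prob p cs (fun S => ~ E S) = 1 - prob p cs E.
Proof.
  unfold prob; rewrite <- expect_compl; f_equal.
  apply functional_extensionality; intros S; apply indic_not.
Qed.

Definition up_event (E : pset -> Prop) : Prop := forall S T, subset S T -> E S -> E T.

Lemma prob_harris (p : R) (cs : list cell) (E G : pset -> Prop) :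
  0 <= p <= 1 -> up_event E -> up_event G ->
  prob p cs E * prob p cs G <= prob p cs (fun S => E S /\ G S).
Proof.
  intros Hp HE HG; unfold prob.
  eapply Rle_trans.
  - apply harris; auto; intros S T HST; apply indic_le; [apply HE | apply HG]; auto.
  - apply expect_le; auto; intros S _; rewrite indic_and; lra.
Qed.

Definition local_event (U : pset) (E : pset -> Prop) : Prop :=
  forall S T, (forall x, U x -> (S x <-> T x)) -> E S -> E T.

Lemma prob_indep (p : R) (cs : list cell) (U V : pset) (E G : pset -> Prop) :
  local_event U E -> local_event V G -> (forall x, U x -> ~ V x) ->
  prob p cs (fun S => E S /\ G S) = prob p cs E * prob p cs G.
Proof.
  intros HE HG HUV; unfold prob.
  rewrite <- (expect_indep p cs U V).
  - f_equal; apply functional_extensionality; intros S; apply indic_and.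
  - intros S T HST; apply indic_iff; split; apply HE; intros x Hx; specialize (HST x Hx); tauto.
  - intros S T HST; apply indic_iff; split; apply HG; intros x Hx; specialize (HST x Hx); tauto.
  - exact HUV.
Qed.

(** A witness is demanded only for sets inside [cs]. Finiteness of the random set thus becomes
    available, which [spans_reach] relies on. *)
Lemma prob_union (p : R) (cs : list cell) (X : Type) (L : list X)
    (E : pset -> Prop) (G : X -> pset -> Prop) (r : R) :
  0 <= p <= 1 ->
  (forall S, (forall x, S x -> In x cs) -> E S -> exists w, In w L /\ G w S) ->
  (forall w, In w L -> prob p cs (G w) <= r) ->
  prob p cs E <= INR (length L) * r.
Proof.
  intros Hp; revert E; induction L as [|w L IH]; intros E HE HG.
  - simpl (length _); rewrite Rmult_0_l.
    rewrite <- (expect_const p cs 0); apply expect_le; auto.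
    intros S HS; rewrite indic_false; [lra|]; intros H; destruct (HE S HS H) as [w [[] _]].
  - apply Rle_trans with (prob p cs (G w) + prob p cs (fun S => exists v, In v L /\ G v S)).
    + unfold prob; rewrite <- expect_plus; apply expect_le; auto; intros S HS.
      pose proof (indic_bounds (G w S)); pose proof (indic_bounds (exists v, In v L /\ G v S)).
      destruct (classic (E S)) as [H1|H1];
        [|rewrite (indic_false _ H1); lra].
      rewrite (indic_true _ H1); destruct (HE S HS H1) as [v [[<-|Hv] Hg]].
      * rewrite (indic_true (G w S)) by assumption; lra.
      * rewrite (indic_true (exists v, In v L /\ G v S)) by eauto; lra.
    + simpl (length _); rewrite S_INR.
      pose proof (HG w (or_introl eq_refl)).
      assert (prob p cs (fun S => exists v, In v L /\ G v S) <= INR (length L) * r).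
      { apply IH; auto; intros v Hv; apply HG; right; auto. }
      lra.
Qed.

(** * Probabilities of containing, avoiding and hitting given cells *)

Lemma prob_cell_notin (p : R) (cs : list cell) (c : cell) :
  ~ In c cs -> prob p cs (fun S => S c) = 0.
Proof.
  unfold prob; induction cs as [|d cs IH]; simpl; intros Hc.
  - apply indic_false; tauto.
  - rewrite IH by tauto.
    replace (fun S : pset => indic (add d S c)) with (fun S : pset => indic (S c)).
    + rewrite IH by tauto; ring.
    + apply functional_extensionality; intros S; apply indic_iff; unfold add.
      split; [tauto | intros [->|]; tauto].
Qed.

Lemma prob_cell (p : R) (cs : list cell) (c : cell) :
  NoDup cs -> In c cs -> prob p cs (fun S => S c) = p.
Proof.
  unfold prob; induction cs as [|d cs IH]; simpl; intros Hnd Hc; [tauto|].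
  inversion Hnd; subst.
  destruct (classic (d = c)) as [->|Hdc].
  - pose proof (prob_cell_notin p cs c) as H0; unfold prob in H0; rewrite H0 by assumption.
    replace (fun S : pset => indic (add c S c)) with (fun _ : pset => 1).
    + rewrite expect_const; ring.
    + apply functional_extensionality; intros S; symmetry; apply indic_true; left; reflexivity.
  - replace (fun S : pset => indic (add d S c)) with (fun S : pset => indic (S c)).
    + rewrite IH by tauto; ring.
    + apply functional_extensionality; intros S; apply indic_iff; unfold add.
      split; [tauto | intros [->|]; tauto].
Qed.

(** [NoDup F] is part of the event, so that a list with repeated cells has probability zero and the
    bound covers every list that an enumeration may produce. Otherwise the cells are independent,
    each present with probability [p] or 0. *)
Lemma prob_contains_le (p : R) (cs F : list cell) :
  0 <= p <= 1 -> NoDup cs ->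
  prob p cs (fun S => NoDup F /\ Forall S F) <= p ^ length F.
Proof.
  intros Hp Hcs; destruct (classic (NoDup F)) as [HF|HF].
  2: { apply Rle_trans with 0; [|apply pow_le; lra].
       rewrite <- (expect_const p cs 0); apply expect_le; auto.
       intros S _; rewrite indic_false by tauto; lra. }
  apply Rle_trans with (prob p cs (fun S => Forall S F)).
  { apply prob_le; auto; intros; tauto. }
  induction HF as [|c F Hc HF IH]; simpl; [apply prob_le_1; auto|].
  apply Rle_trans with (prob p cs (fun S => S c /\ Forall S F)).
  { apply prob_le; auto; intros S _ H; inversion H; auto. }
  rewrite (prob_indep p cs (fun x => x = c) (fun x => In x F)).
  - apply Rmult_le_compat; auto using prob_nonneg.
    destruct (classic (In c cs)); [rewrite prob_cell by assumption; lra|].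
    rewrite prob_cell_notin by assumption; lra.
  - intros S T HST; apply HST; reflexivity.
  - intros S T HST; rewrite !Forall_forall; intros HS x Hx; apply HST; auto.
  - intros x ->; exact Hc.
Qed.

Lemma prob_avoids (p : R) (cs F : list cell) :
  0 <= p <= 1 -> NoDup cs -> NoDup F -> incl F cs ->
  prob p cs (fun S => forall x, In x F -> ~ S x) = (1 - p) ^ length F.
Proof.
  intros Hp Hcs HF; induction HF as [|c F Hc HF IH]; intros Hincl; simpl.
  - apply prob_true; simpl; tauto.
  - rewrite <- IH by (intros x Hx; apply Hincl; right; auto).
    replace (1 - p) with (prob p cs (fun S => ~ S c)).
    2: { rewrite prob_not, prob_cell; auto; apply Hincl; left; reflexivity. }
    rewrite <- (prob_indep p cs (fun x => x = c) (fun x => In x F)).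
    + unfold prob; f_equal; apply functional_extensionality; intros S; apply indic_iff.
      split.
      * intros H; split; intros; apply H; auto.
      * intros [H1 H2] x [<-|Hx]; auto.
    + intros S T HST H HT; apply H, HST; auto.
    + intros S T HST H x Hx HT; apply (H x Hx), HST; auto.
    + intros x ->; exact Hc.
Qed.

Lemma prob_hits (p : R) (cs F : list cell) :
  0 <= p <= 1 -> NoDup cs -> NoDup F -> incl F cs ->
  prob p cs (fun S => exists x, In x F /\ S x) = 1 - (1 - p) ^ length F.
Proof.
  intros Hp Hcs HF Hincl; rewrite <- (prob_avoids p cs F) by assumption.
  rewrite <- prob_not; unfold prob; f_equal; apply functional_extensionality; intros S.
  apply indic_iff; split.
  - intros [x [H1 H2]] H; exact (H x H1 H2).
  - intros H; apply NNPP; intros H1; apply H; intros x H2 H3; apply H1; eauto.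
Qed.

(** Hitting a segment is an increasing event, so [prob_harris] gives the product bound without
    disjointness of the segments. *)
Lemma prob_hits_all (p : R) (cs : list cell) (seg : nat -> list cell) (n k : nat) :
  0 <= p <= 1 -> NoDup cs ->
  (forall t, (t < k)%nat -> NoDup (seg t) /\ incl (seg t) cs /\ length (seg t) = n) ->
  (1 - (1 - p) ^ n) ^ k <=
  prob p cs (fun S => forall t, (t < k)%nat -> exists x, In x (seg t) /\ S x).
Proof.
  intros Hp Hcs; induction k as [|k IH]; intros Hseg; simpl.
  - rewrite prob_true; [lra | intros; lia].
  - destruct (Hseg k (Nat.lt_succ_diag_r k)) as [H1 [H2 H3]].
    assert (Hn : 0 <= (1 - p) ^ n <= 1).
    { split; [apply pow_le; lra|].
      pose proof (pow_incr (1 - p) 1 n ltac:(lra)) as H; rewrite pow1 in H; exact H. }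
    assert (Hk : forall t, (t < k)%nat ->
              NoDup (seg t) /\ incl (seg t) cs /\ length (seg t) = n).
    { intros t Ht; apply Hseg; lia. }
    eapply Rle_trans; [apply Rmult_le_compat_l; [lra | exact (IH Hk)]|].
    rewrite <- H3 at 1; rewrite <- (prob_hits p cs) by assumption.
    eapply Rle_trans; [apply prob_harris; auto|].
    + intros S T HST [x [Hx1 Hx2]]; eauto.
    + intros S T HST H t Ht; destruct (H t Ht) as [x [Hx1 Hx2]]; eauto.
    + apply prob_le; auto; intros S _ [G1 G2] t Ht.
      destruct (Nat.eq_dec t k) as [->|]; auto; apply G2; lia.
Qed.

(* The lines [U y] are disjoint, so their events [E y] are independent. *)
Lemma prob_some_line (p q : R) (cs : list cell) (ys : list nat)
    (U : nat -> pset) (E : nat -> pset -> Prop) :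
  0 <= p <= 1 -> q <= 1 -> NoDup ys ->
  (forall y z x, U y x -> U z x -> y = z) ->
  (forall y, In y ys -> local_event (U y) (E y) /\ q <= prob p cs (E y)) ->
  1 - (1 - q) ^ length ys <= prob p cs (fun S => exists y, In y ys /\ E y S).
Proof.
  intros Hp Hq Hnd HU HE.
  assert (H : prob p cs (fun S => forall y, In y ys -> ~ E y S) <= (1 - q) ^ length ys).
  { induction Hnd as [|y ys Hy Hnd IH]; simpl; [apply prob_le_1; auto|].
    apply Rle_trans with
      (prob p cs (fun S => ~ E y S /\ forall z, In z ys -> ~ E z S)).
    { apply prob_le; auto; intros S _ H; split; intros; apply H; simpl; auto. }
    rewrite (prob_indep p cs (U y) (fun x => exists z, In z ys /\ U z x)).
    - apply Rmult_le_compat; auto using prob_nonneg.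
      + rewrite prob_not; destruct (HE y (or_introl eq_refl)); lra.
      + apply IH; intros z Hz; apply HE; right; auto.
    - intros S T HST H HT; apply H.
      apply (proj1 (HE y (or_introl eq_refl)) T); auto.
      intros x Hx; specialize (HST x Hx); tauto.
    - intros S T HST H z Hz HT; apply (H z Hz).
      apply (proj1 (HE z (or_intror Hz)) T); auto.
      intros x Hx; symmetry; apply HST; eauto.
    - intros x Hx [z [Hz Hzx]]; rewrite (HU y z x Hx Hzx) in Hy; auto. }
  apply Rle_trans with (1 - prob p cs (fun S => forall y, In y ys -> ~ E y S)); [lra|].
  rewrite <- prob_not; apply prob_le; auto; intros S _ H1; apply NNPP; intros H2.
  apply H1; intros y Hy HEy; apply H2; eauto.
Qed.

(** * Filling lines one at a time *)

(* A path lists the lines that get filled, the last one first: [true] stands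
   for a row, [false] for a column. *)
Fixpoint nrows (w : list bool) : nat :=
  match w with nil => 0 | true :: w' => S (nrows w') | false :: w' => nrows w' end.

Fixpoint ncols (w : list bool) : nat :=
  match w with nil => 0 | true :: w' => ncols w' | false :: w' => S (ncols w') end.

(* [R] and [C] are the rows and columns filled along the path, [F] the points
   of [S] used for that. *)
Inductive reach (a b : nat) (S : pset) :
  list bool -> list nat -> list nat -> list cell -> Prop :=
| reach_nil : reach a b S nil nil nil nil
| reach_row w R C F y xs :
    reach a b S w R C F -> ~ In y R -> NoDup xs -> length xs = (a - ncols w)%nat ->
    (forall x, In x xs -> ~ In x C /\ S (x, y)) ->
    reach a b S (true :: w) (y :: R) C (map (fun x => (x, y)) xs ++ F)
| reach_col w R C F x ys :
    reach a b S w R C F -> ~ In x C -> NoDup ys -> length ys = (b - nrows w)%nat ->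
    (forall y, In y ys -> ~ In y R /\ S (x, y)) ->
    reach a b S (false :: w) R (x :: C) (map (fun y => (x, y)) ys ++ F).

Lemma reach_lines (a b : nat) (S : pset) w R C F :
  reach a b S w R C F ->
  length R = nrows w /\ length C = ncols w /\ NoDup R /\ NoDup C.
Proof.
  induction 1; simpl.
  - repeat split; constructor.
  - destruct IHreach as [? [? [? ?]]]; repeat split; auto; constructor; auto.
  - destruct IHreach as [? [? [? ?]]]; repeat split; auto; constructor; auto.
Qed.

Lemma NoDup_map_inj (X Y : Type) (f : X -> Y) (l : list X) :
  (forall x y, f x = f y -> x = y) -> NoDup l -> NoDup (map f l).
Proof.
  intros Hf; induction 1 as [|x l Hx Hl IH]; simpl; constructor; auto.
  intros H; apply in_map_iff in H; destruct H as [z [Hz Hin]]; apply Hf in Hz; subst; auto.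
Qed.

(** Earlier points lie on lines already filled, whereas the points of a new line avoid all of these;
    hence no point is used twice and [F] costs the full power of [p]. *)
Lemma reach_points (a b : nat) (S : pset) w R C F :
  reach a b S w R C F ->
  NoDup F /\ Forall S F /\ forall x, In x F -> In (snd x) R \/ In (fst x) C.
Proof.
  induction 1 as [|w R C F y xs Hr [I1 [I2 I3]] Hy Hnd _ Hxs
                  |w R C F x ys Hr [I1 [I2 I3]] Hx Hnd _ Hys].
  - repeat split; try constructor; simpl; tauto.
  - repeat split.
    + apply NoDup_app; auto.
      * apply NoDup_map_inj; auto; congruence.
      * intros z Hz HF; apply in_map_iff in Hz; destruct Hz as [x [<- Hx]].
        destruct (I3 _ HF); simpl in *; auto; apply (Hxs x Hx); auto.
    + apply Forall_app; split; auto; apply Forall_forall; intros z Hz.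
      apply in_map_iff in Hz; destruct Hz as [x [<- Hx]]; apply Hxs; auto.
    + intros z Hz; apply in_app_iff in Hz; destruct Hz as [Hz|Hz].
      * apply in_map_iff in Hz; destruct Hz as [x [<- Hx]]; simpl; auto.
      * destruct (I3 _ Hz); simpl; auto.
  - repeat split.
    + apply NoDup_app; auto.
      * apply NoDup_map_inj; auto; congruence.
      * intros z Hz HF; apply in_map_iff in Hz; destruct Hz as [y [<- Hy]].
        destruct (I3 _ HF); simpl in *; auto; apply (Hys y Hy); auto.
    + apply Forall_app; split; auto; apply Forall_forall; intros z Hz.
      apply in_map_iff in Hz; destruct Hz as [y [<- Hy]]; apply Hys; auto.
    + intros z Hz; apply in_app_iff in Hz; destruct Hz as [Hz|Hz].
      * apply in_map_iff in Hz; destruct Hz as [y [<- Hy]]; simpl; auto.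
      * destruct (I3 _ Hz); simpl; auto.
Qed.

Lemma NoDup_firstn (n : nat) (l : list nat) : NoDup l -> NoDup (firstn n l).
Proof. rewrite <- (firstn_skipn n l) at 1; apply NoDup_app_remove_r. Qed.

(** * From a filling path to spanning *)

Lemma Titer_mono (a b : nat) (S : pset) (s t : nat) (x : cell) :
  (s <= t)%nat -> Titer a b s S x -> Titer a b t S x.
Proof. induction 1; auto; intros H1; left; auto. Qed.

Lemma Titer_row (a b : nat) (S : pset) (t : nat) (y : nat) (l : list nat) :
  NoDup l -> (a <= length l)%nat -> (forall x, In x l -> Titer a b t S (x, y)) ->
  forall x, Titer a b (Datatypes.S t) S (x, y).
Proof.
  intros Hnd Hl Hin x; destruct (classic (Titer a b t S (x, y))); [left; auto|].
  right; split; auto; left; exists (firstn a l); repeat split.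
  - apply NoDup_firstn; auto.
  - apply firstn_length_le; auto.
  - apply Forall_forall; intros z Hz; apply Hin; rewrite <- (firstn_skipn a l).
    apply in_app_iff; auto.
Qed.

Lemma Titer_col (a b : nat) (S : pset) (t : nat) (x : nat) (l : list nat) :
  NoDup l -> (b <= length l)%nat -> (forall y, In y l -> Titer a b t S (x, y)) ->
  forall y, Titer a b (Datatypes.S t) S (x, y).
Proof.
  intros Hnd Hl Hin y; destruct (classic (Titer a b t S (x, y))); [left; auto|].
  right; split; auto; right; exists (firstn b l); repeat split.
  - apply NoDup_firstn; auto.
  - apply firstn_length_le; auto.
  - apply Forall_forall; intros z Hz; apply Hin; rewrite <- (firstn_skipn b l).
    apply in_app_iff; auto.
Qed.

(** A new row already meets each of the [ncols w] filled columns, and its points [xs] lie off these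
    columns; together they make at least [a] occupied points. Columns are symmetric. *)
Lemma reach_filled (a b : nat) (S : pset) w R C F :
  reach a b S w R C F ->
  exists t, (forall x y, In y R -> Titer a b t S (x, y)) /\
            (forall x y, In x C -> Titer a b t S (x, y)).
Proof.
  induction 1 as [|w R C F y xs Hr [t [I1 I2]] Hy Hnd Hlen Hxs
                  |w R C F x ys Hr [t [I1 I2]] Hx Hnd Hlen Hys].
  - exists 0%nat; simpl; tauto.
  - destruct (reach_lines _ _ _ _ _ _ _ Hr) as [L1 [L2 [L3 L4]]].
    exists (Datatypes.S t); split.
    + intros x z [<-|Hz]; [|left; apply I1; auto].
      apply (Titer_row a b S t y (C ++ xs)).
      * apply NoDup_app; auto; intros u Hu1 Hu2; apply (Hxs u Hu2); auto.
      * rewrite length_app; lia.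
      * intros u Hu; apply in_app_iff in Hu; destruct Hu as [Hu|Hu]; auto.
        apply Titer_mono with 0%nat; [lia|]; apply Hxs; auto.
    + intros u z Hu; left; apply I2; auto.
  - destruct (reach_lines _ _ _ _ _ _ _ Hr) as [L1 [L2 [L3 L4]]].
    exists (Datatypes.S t); split.
    + intros u z Hu; left; apply I1; auto.
    + intros u z [<-|Hz]; [|left; apply I2; auto].
      apply (Titer_col a b S t x (R ++ ys)).
      * apply NoDup_app; auto; intros v Hv1 Hv2; apply (Hys v Hv2); auto.
      * rewrite length_app; lia.
      * intros v Hv; apply in_app_iff in Hv; destruct Hv as [Hv|Hv]; auto.
        apply Titer_mono with 0%nat; [lia|]; apply Hys; auto.
Qed.

Lemma reach_spans (a b : nat) (S : pset) w R C F :
  reach a b S w R C F -> (a <= ncols w \/ b <= nrows w)%nat -> spans a b S.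
Proof.
  intros Hr Hw [x y].
  destruct (reach_lines _ _ _ _ _ _ _ Hr) as [L1 [L2 [L3 L4]]].
  destruct (reach_filled _ _ _ _ _ _ _ Hr) as [t [T1 T2]].
  exists (Datatypes.S t); destruct Hw as [Hw|Hw].
  - apply (Titer_row a b S t y C); auto; lia.
  - apply (Titer_col a b S t x R); auto; lia.
Qed.

(** * From spanning to a filling path, stopped at given numbers of lines *)

Fixpoint valid (A' B' : nat) (w : list bool) : Prop :=
  match w with
  | nil => True
  | _ :: w' => (ncols w' < A')%nat /\ (nrows w' < B')%nat /\ valid A' B' w'
  end.

Lemma length_path (w : list bool) : length w = (ncols w + nrows w)%nat.
Proof. induction w as [|[] w IH]; simpl; lia. Qed.

(** At most [length C] members of [l] can lie in [C], and all others satisfy [P]. This extracts the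
    initial points of a line from its occupied ones, the rest being crossings with filled lines. *)
Lemma split_by_list (P : nat -> Prop) (C l : list nat) :
  NoDup C -> NoDup l -> (forall x, In x l -> In x C \/ P x) ->
  exists xs, NoDup xs /\ length xs = (length l - length C)%nat /\
    forall x, In x xs -> ~ In x C /\ P x.
Proof.
  intros HC Hl HP.
  set (g := filter (fun x => if in_dec Nat.eq_dec x C then false else true) l).
  set (h := filter (fun x => if in_dec Nat.eq_dec x C then true else false) l).
  assert (Hlen : (length l = length g + length h)%nat).
  { unfold g, h; clear; induction l as [|x l IH]; simpl; auto.
    destruct (in_dec Nat.eq_dec x C); simpl; lia. }
  assert (Hh : (length h <= length C)%nat).
  { apply NoDup_incl_length; [apply NoDup_filter; auto|].
    intros x Hx; apply filter_In in Hx; destruct (in_dec Nat.eq_dec x C); intuition congruence. }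
  exists (firstn (length l - length C) g); repeat split.
  - apply NoDup_firstn, NoDup_filter; auto.
  - apply firstn_length_le; lia.
  - assert (Hx : In x g) by (rewrite <- (firstn_skipn (length l - length C) g);
                             apply in_app_iff; auto).
    apply filter_In in Hx; destruct (in_dec Nat.eq_dec x C); intuition congruence.
  - assert (Hx : In x g) by (rewrite <- (firstn_skipn (length l - length C) g);
                             apply in_app_iff; auto).
    apply filter_In in Hx; destruct (in_dec Nat.eq_dec x C) as [|n]; [intuition congruence|].
    destruct (HP x (proj1 Hx)); tauto.
Qed.

(* If no line can be added, then [S] together with the filled lines is closed
   under [Tstep], hence a finite [S] does not span. *)
Lemma reach_extend (a b : nat) (S : pset) w R C F (K : nat) :
  (forall x, S x -> (fst x < K /\ snd x < K)%nat) -> spans a b S ->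
  reach a b S w R C F ->
  exists c R' C' F', reach a b S (c :: w) R' C' F'.
Proof.
  intros HK Hs Hr; apply NNPP; intros Hno.
  destruct (reach_lines _ _ _ _ _ _ _ Hr) as [L1 [L2 [L3 L4]]].
  set (G := fun x : cell => S x \/ In (snd x) R \/ In (fst x) C).
  assert (HG : forall t x, Titer a b t S x -> G x).
  { induction t as [|t IH]; intros [x y] Hx; [left; exact Hx|].
    destruct Hx as [Hx|[_ [[l [N1 [N2 N3]]]|[l [N1 [N2 N3]]]]]]; auto.
    - destruct (classic (In y R)) as [|HyR]; [right; left; auto|]; exfalso.
      simpl in N3; rewrite Forall_forall in N3.
      destruct (split_by_list (fun x => S (x, y)) C l) as [xs [X1 [X2 X3]]]; auto.
      { intros u Hu; destruct (IH _ (N3 u Hu)) as [|[|]]; simpl in *; tauto. }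
      apply Hno; exists true, (y :: R), C; eexists.
      apply reach_row; eauto; rewrite X2, N2, L2; reflexivity.
    - destruct (classic (In x C)) as [|HxC]; [right; right; auto|]; exfalso.
      simpl in N3; rewrite Forall_forall in N3.
      destruct (split_by_list (fun y => S (x, y)) R l) as [ys [X1 [X2 X3]]]; auto.
      { intros u Hu; destruct (IH _ (N3 u Hu)) as [|[|]]; simpl in *; tauto. }
      apply Hno; exists false, R, (x :: C); eexists.
      apply reach_col; eauto; rewrite X2, N2, L1; reflexivity. }
  (* The cell [(z, z)] lies beyond all points of [S] and beyond every filled line, hence outside
     [G]. *)
  set (z := Datatypes.S (K + list_max R + list_max C)).
  assert (Hmax : forall l, In z l -> (z <= list_max l)%nat).
  { intros l Hl; pose proof (proj1 (list_max_le l (list_max l)) (le_n _)) as H.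
    rewrite Forall_forall in H; auto. }
  destruct (Hs (z, z)) as [t Ht]; destruct (HG t _ Ht) as [H|[H|H]]; simpl in H.
  - destruct (HK _ H); simpl in *; unfold z in *; lia.
  - apply Hmax in H; unfold z in *; lia.
  - apply Hmax in H; unfold z in *; lia.
Qed.

(** If the thresholds were never met, [reach_extend] would produce valid paths of every length; one
    with [A' + B'] steps must have [A'] columns or [B'] rows. *)
Lemma spans_reach (a b A' B' : nat) (S : pset) (K : nat) :
  (forall x, S x -> (fst x < K /\ snd x < K)%nat) -> spans a b S ->
  exists w R C F, reach a b S w R C F /\ valid A' B' w /\
    (A' <= ncols w \/ B' <= nrows w)%nat.
Proof.
  intros HK Hs; apply NNPP; intros Hno.
  assert (H : forall n, exists w R C F,
             reach a b S w R C F /\ valid A' B' w /\ length w = n).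
  { induction n as [|n [w [R [C [F [Hr [Hv Hl]]]]]]].
    - exists nil, nil, nil, nil; repeat split; constructor.
    - destruct (classic (A' <= ncols w \/ B' <= nrows w)%nat) as [|Hlt].
      { exfalso; apply Hno; exists w, R, C, F; auto. }
      destruct (reach_extend a b S w R C F K) as [c [R' [C' [F' Hr']]]]; auto.
      exists (c :: w), R', C', F'; simpl; repeat split; auto; lia. }
  destruct (H (A' + B')%nat) as [w [R [C [F [Hr [Hv Hl]]]]]].
  apply Hno; exists w, R, C, F; repeat split; auto; rewrite length_path in Hl; lia.
Qed.

Lemma valid_bound (A' B' : nat) (w : list bool) :
  valid A' B' w -> (ncols w <= A' /\ nrows w <= B')%nat.
Proof.
  induction w as [|[] w IH]; simpl; intros H; [lia| |];
    destruct H as [? [? H]]; apply IH in H; lia.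
Qed.

(** * Union bound over filling paths *)

Definition box (N M : nat) : list cell := list_prod (seq 0 N) (seq 0 M).

Lemma in_box (N M : nat) (x : cell) :
  In x (box N M) <-> (fst x < N /\ snd x < M)%nat.
Proof. destruct x as [x y]; unfold box; rewrite in_prod_iff, !in_seq; simpl; lia. Qed.

Lemma NoDup_box (N M : nat) : NoDup (box N M).
Proof.
  unfold box; generalize (seq_NoDup N 0); induction 1 as [|x l Hx Hl IH]; simpl.
  - constructor.
  - apply NoDup_app; auto.
    + apply NoDup_map_inj; [congruence | apply seq_NoDup].
    + intros z H1 H2; apply in_map_iff in H1; destruct H1 as [y [<- _]].
      apply in_prod_iff in H2; tauto.
Qed.

Lemma span_prob_expect (a b : nat) (p : R) (cs chosen : list cell) :
  span_prob a b p cs chosen =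
  expect p cs (fun S => indic (spans a b (fun x => S x \/ In x chosen))).
Proof.
  revert chosen; induction cs as [|c cs IH]; intros chosen; simpl.
  - replace (fun x => False \/ In x chosen) with (fun x => In x chosen); [reflexivity|].
    apply pset_ext; tauto.
  - rewrite !IH; do 2 f_equal; f_equal; apply functional_extensionality; intros S.
    f_equal; f_equal; apply pset_ext; intros x; simpl; unfold add.
    split; intros H; intuition congruence.
Qed.

Lemma P_span_prob (a b N M : nat) (p : R) :
  P_span a b N M p = prob p (box N M) (spans a b).
Proof.
  unfold P_span, prob; rewrite span_prob_expect; unfold box; f_equal.
  apply functional_extensionality; intros S; do 2 f_equal.
  apply pset_ext; simpl; tauto.
Qed.

Lemma spans_swap (a b : nat) (S : pset) :
  spans a b S -> spans b a (fun x => S (swap x)).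
Proof.
  intros H; assert (Ht : forall t x, Titer a b t S (swap x) ->
                      Titer b a t (fun x => S (swap x)) x).
  { induction t as [|t IH]; intros [x y] Hx; [exact Hx|].
    destruct (classic (Titer b a t (fun x => S (swap x)) (x, y))) as [|Hn]; [left; auto|].
    destruct Hx as [Hx|[_ Hx]]; [left; auto|].
    right; split; auto.
    destruct Hx as [[l [H1 [H2 H3]]]|[l [H1 [H2 H3]]]]; [right|left]; exists l;
      repeat split; auto; eapply Forall_impl; eauto; simpl; intros u Hu;
      apply IH; exact Hu. }
  intros x; destruct (H (swap x)) as [t Hx]; exists t; auto.
Qed.

Lemma P_span_swap (a b N M : nat) (p : R) : P_span a b N M p = P_span b a M N p.
Proof.
  rewrite !P_span_prob; unfold prob.
  rewrite <- (expect_permutation p (map swap (box N M)) (box M N)).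
  - rewrite expect_swap; f_equal; apply functional_extensionality; intros S.
    apply indic_iff; split; [apply spans_swap|].
    intros H; apply spans_swap in H.
    replace S with (fun x => S (swap (swap x))); [exact H|].
    apply functional_extensionality; intros x; rewrite swap_swap; reflexivity.
  - apply NoDup_Permutation; auto using NoDup_box.
    + apply NoDup_map_inj; auto using NoDup_box.
      intros x y H; rewrite <- (swap_swap x), H; apply swap_swap.
    + intros x; rewrite in_map_iff, in_box; split.
      * intros [y [<- Hy]]; apply in_box in Hy; unfold swap; simpl; lia.
      * intros H; exists (swap x); split; [apply swap_swap|].
        apply in_box; unfold swap; simpl; lia.
Qed.

(** * Counting the point sets that can realise a path *)

Fixpoint tuples (X : Type) (k : nat) (l : list X) : list (list X) :=
  match k with
  | O => [nil]
  | S k' => flat_map (fun x => map (cons x) (tuples X k' l)) l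
  end.

Lemma length_tuples (X : Type) (k : nat) (l : list X) :
  length (tuples X k l) = (length l ^ k)%nat.
Proof.
  induction k as [|k IH]; simpl; auto.
  rewrite (flat_map_constant_length (c := (length l ^ k)%nat)); auto.
  intros x _; rewrite length_map; auto.
Qed.

Lemma in_tuples (X : Type) (s l : list X) : incl s l -> In s (tuples X (length s) l).
Proof.
  induction s as [|x s IH]; simpl; intros H; auto.
  apply in_flat_map; exists x; split; [apply H; left; auto|].
  apply in_map, IH; intros z Hz; apply H; right; auto.
Qed.

(** Candidates for the list [F] of [reach]. Distinctness is not imposed, which makes their number an
    exact product over the steps. *)
Fixpoint witnesses (a b N M : nat) (w : list bool) : list (list cell) :=
  match w with
  | nil => [nil]
  | true :: w' =>
      flat_map (fun y => flat_map (fun xs =>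
        map (fun F => map (fun x => (x, y)) xs ++ F) (witnesses a b N M w'))
        (tuples nat (a - ncols w') (seq 0 N))) (seq 0 M)
  | false :: w' =>
      flat_map (fun x => flat_map (fun ys =>
        map (fun F => map (fun y => (x, y)) ys ++ F) (witnesses a b N M w'))
        (tuples nat (b - nrows w') (seq 0 M))) (seq 0 N)
  end.

Fixpoint points (a b : nat) (w : list bool) : nat :=
  match w with
  | nil => 0
  | true :: w' => (a - ncols w') + points a b w'
  | false :: w' => (b - nrows w') + points a b w'
  end.

(** The first-moment bound for a path: the number of candidates times [p] to the number of points,
    written as one factor per step. *)
Fixpoint weight (a b N M : nat) (p : R) (w : list bool) : R :=
  match w with
  | nil => 1
  | true :: w' => INR M * (INR N * p) ^ (a - ncols w') * weight a b N M p w'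
  | false :: w' => INR N * (INR M * p) ^ (b - nrows w') * weight a b N M p w'
  end.

Lemma weight_witnesses (a b N M : nat) (p : R) (w : list bool) :
  INR (length (witnesses a b N M w)) * p ^ points a b w = weight a b N M p w.
Proof.
  induction w as [|[] w IH]; simpl; [ring| |]; rewrite <- IH.
  - rewrite (flat_map_constant_length
               (c := (N ^ (a - ncols w) * length (witnesses a b N M w))%nat)).
    + rewrite length_seq, !mult_INR, pow_INR, pow_add, Rpow_mult_distr; ring.
    + intros y _; rewrite (flat_map_constant_length (c := length (witnesses a b N M w))).
      * rewrite length_tuples, length_seq; auto.
      * intros; apply length_map.
  - rewrite (flat_map_constant_length
               (c := (M ^ (b - nrows w) * length (witnesses a b N M w))%nat)).
    + rewrite length_seq, !mult_INR, pow_INR, pow_add, Rpow_mult_distr; ring.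
    + intros y _; rewrite (flat_map_constant_length (c := length (witnesses a b N M w))).
      * rewrite length_tuples, length_seq; auto.
      * intros; apply length_map.
Qed.

Lemma length_witness (a b N M : nat) (w : list bool) (F : list cell) :
  In F (witnesses a b N M w) -> length F = points a b w.
Proof.
  assert (Ht : forall k (l s : list nat), In s (tuples nat k l) -> length s = k).
  { induction k as [|k IH]; simpl; intros l s H; [destruct H as [<-|[]]; auto|].
    apply in_flat_map in H; destruct H as [x [_ H]]; apply in_map_iff in H.
    destruct H as [s' [<- H]]; simpl; f_equal; eauto. }
  revert F; induction w as [|[] w IH]; simpl; intros F H.
  - destruct H as [<-|[]]; auto.
  - apply in_flat_map in H; destruct H as [y [_ H]].
    apply in_flat_map in H; destruct H as [xs [Hxs H]].
    apply in_map_iff in H; destruct H as [F' [<- H]].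
    rewrite length_app, length_map, (IH _ H), (Ht _ _ _ Hxs); auto.
  - apply in_flat_map in H; destruct H as [y [_ H]].
    apply in_flat_map in H; destruct H as [xs [Hxs H]].
    apply in_map_iff in H; destruct H as [F' [<- H]].
    rewrite length_app, length_map, (IH _ H), (Ht _ _ _ Hxs); auto.
Qed.

Lemma reach_in_witnesses (a b N M : nat) (S : pset) w R C F :
  (forall x, S x -> In x (box N M)) ->
  valid a b w -> reach a b S w R C F -> In F (witnesses a b N M w).
Proof.
  intros HS Hv Hr; revert Hv.
  induction Hr as [|w R C F y xs Hr IH Hy Hnd Hlen Hxs
                  |w R C F x ys Hr IH Hx Hnd Hlen Hys]; simpl; intros Hv; auto.
  - destruct Hv as [V1 [V2 V3]].
    assert (Hin : forall x, In x xs -> (x < N /\ y < M)%nat).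
    { intros x Hx; apply (in_box N M (x, y)), HS, Hxs; auto. }
    apply in_flat_map; exists y; split.
    (* Validity makes [a - ncols w] positive, so the row contains a point of the box and [y] is in
       range; a row filled without points could lie anywhere. *)
    + destruct xs as [|x xs]; simpl in Hlen; [lia|].
      apply in_seq; specialize (Hin x (or_introl eq_refl)); lia.
    + apply in_flat_map; exists xs; split; [|apply in_map_iff; eauto].
      rewrite <- Hlen; apply in_tuples; intros x Hx; apply in_seq.
      specialize (Hin x Hx); lia.
  - destruct Hv as [V1 [V2 V3]].
    assert (Hin : forall y, In y ys -> (x < N /\ y < M)%nat).
    { intros y Hy; apply (in_box N M (x, y)), HS, Hys; auto. }
    apply in_flat_map; exists x; split.
    + destruct ys as [|y ys]; simpl in Hlen; [lia|].
      apply in_seq; specialize (Hin y (or_introl eq_refl)); lia.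
    + apply in_flat_map; exists ys; split; [|apply in_map_iff; eauto].
      rewrite <- Hlen; apply in_tuples; intros y Hy; apply in_seq.
      specialize (Hin y Hy); lia.
Qed.

Lemma valid_weaken (A' B' a b : nat) (w : list bool) :
  (A' <= a)%nat -> (B' <= b)%nat -> valid A' B' w -> valid a b w.
Proof.
  intros HA HB; induction w as [|c w IH]; simpl; auto.
  intros [? [? ?]]; repeat split; auto; lia.
Qed.

Definition paths (n : nat) : list (list bool) :=
  flat_map (fun l => tuples bool l [true; false]) (seq 0 (S n)).

Lemma in_paths (n : nat) (w : list bool) : (length w <= n)%nat -> In w (paths n).
Proof.
  intros H; apply in_flat_map; exists (length w); split; [apply in_seq; lia|].
  apply in_tuples; intros [] _; simpl; auto.
Qed.

(** Two nested union bounds: over the paths with at most [A' + B'] steps, then over the candidate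
    point lists of each path. *)
Lemma P_span_upper (a b A' B' N M : nat) (p r : R) :
  0 <= p <= 1 -> 0 <= r -> (A' <= a)%nat -> (B' <= b)%nat ->
  (forall w, valid A' B' w -> (A' <= ncols w \/ B' <= nrows w)%nat ->
     weight a b N M p w <= r) ->
  P_span a b N M p <= INR (length (paths (A' + B'))) * r.
Proof.
  intros Hp Hr HA HB Hw; rewrite P_span_prob.
  apply (prob_union p (box N M) (list bool) (paths (A' + B')) (spans a b)
    (fun w S => (valid A' B' w /\ (A' <= ncols w \/ B' <= nrows w)%nat) /\
       exists F, In F (witnesses a b N M w) /\ NoDup F /\ Forall S F)); auto.
  - intros S HS Hspan.
    destruct (spans_reach a b A' B' S (N + M)) as [w [R [C [F [H1 [H2 H3]]]]]]; auto.
    { intros x Hx; apply HS, in_box in Hx; lia. }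
    destruct (reach_points _ _ _ _ _ _ _ H1) as [F1 [F2 _]].
    exists w; split; [|split; [auto|exists F; split; auto]].
    + apply in_paths; rewrite length_path; apply valid_bound in H2; lia.
    + eapply reach_in_witnesses; eauto; eapply valid_weaken; eauto.
  - intros w _.
    destruct (classic (valid A' B' w /\ (A' <= ncols w \/ B' <= nrows w)%nat)) as [Hv|Hv].
    + apply Rle_trans with (weight a b N M p w); [|apply Hw; tauto].
      rewrite <- weight_witnesses.
      apply (prob_union p (box N M) (list cell) (witnesses a b N M w) _
               (fun F S => NoDup F /\ Forall S F)); auto.
      * intros S _ [_ H]; exact H.
      * intros F HF; rewrite <- (length_witness a b N M w F HF).
        apply prob_contains_le; auto using NoDup_box.
    + apply Rle_trans with 0; auto.
      rewrite <- (expect_const p (box N M) 0); apply expect_le; auto.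
      intros S _; rewrite indic_false by tauto; lra.
Qed.

(** * Realising a path in disjoint strips *)

(* The strips [[s m, (s+1) m)], [s < L], provide the rows to be filled; the
   points filling them are found in the columns [[(L+t) n, (L+t+1) n)].  Columns
   are treated symmetrically, so that rows and columns use disjoint points. *)
Definition row_event (L n m s k : nat) (S : pset) : Prop :=
  exists y, In y (seq (s * m) m) /\
    forall t, (t < k)%nat ->
      exists c, In c (map (fun x => (x, y)) (seq ((L + t) * n) n)) /\ S c.

Definition col_event (L n m s k : nat) (S : pset) : Prop :=
  exists x, In x (seq (s * n) n) /\
    forall t, (t < k)%nat ->
      exists c, In c (map (fun y => (x, y)) (seq ((L + t) * m) m)) /\ S c.

(** The number of earlier steps, [length w'], serves as the index of the strip, so each step
    searches for its line in a strip of its own. *)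
Fixpoint path_event (a b L n m : nat) (w : list bool) (S : pset) : Prop :=
  match w with
  | nil => True
  | true :: w' =>
      row_event L n m (length w') (a - ncols w') S /\ path_event a b L n m w' S
  | false :: w' =>
      col_event L n m (length w') (b - nrows w') S /\ path_event a b L n m w' S
  end.

Lemma row_event_up (L n m s k : nat) : up_event (row_event L n m s k).
Proof.
  intros S T HST [y [Hy H]]; exists y; split; auto; intros t Ht.
  destruct (H t Ht) as [c [H1 H2]]; eauto.
Qed.

Lemma col_event_up (L n m s k : nat) : up_event (col_event L n m s k).
Proof.
  intros S T HST [y [Hy H]]; exists y; split; auto; intros t Ht.
  destruct (H t Ht) as [c [H1 H2]]; eauto.
Qed.

Lemma path_event_up (a b L n m : nat) (w : list bool) : up_event (path_event a b L n m w).
Proof.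
  induction w as [|[] w IH]; simpl; intros S T HST H; auto; destruct H as [H1 H2]; split.
  - eapply row_event_up; eauto.
  - eapply IH; eauto.
  - eapply col_event_up; eauto.
  - eapply IH; eauto.
Qed.

Lemma choose_points (Q : nat -> Prop) (L n k : nat) :
  (forall t, (t < k)%nat -> exists x, ((L + t) * n <= x < (L + t) * n + n)%nat /\ Q x) ->
  exists xs, NoDup xs /\ length xs = k /\
    forall x, In x xs -> (L * n <= x < (L + k) * n)%nat /\ Q x.
Proof.
  induction k as [|k IH]; intros H.
  - exists nil; repeat split; try constructor; simpl in *; tauto.
  - destruct IH as [xs [X1 [X2 X3]]]; [intros; apply H; lia|].
    destruct (H k) as [x [Hx HQ]]; [lia|].
    exists (x :: xs); repeat split; simpl.
    + constructor; auto; intros Hin; apply X3 in Hin; lia.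
    + lia.
    + destruct H0 as [<-|H0]; [nia | apply X3 in H0; lia].
    + destruct H0 as [<-|H0]; [nia | apply X3 in H0; nia].
    + destruct H0 as [<-|H0]; [auto | apply X3 in H0; tauto].
Qed.

(** The bounds on [R] and [C] are the induction invariant. They make the line found in strip
    [length w] new, and they keep the filled lines away from the blocks of index at least [L], where
    the points are taken. *)
Lemma path_event_reach (a b L n m : nat) (w : list bool) (S : pset) :
  (length w <= L)%nat -> path_event a b L n m w S ->
  exists R C F, reach a b S w R C F /\
    (forall y, In y R -> (y < length w * m)%nat) /\
    (forall x, In x C -> (x < length w * n)%nat).
Proof.
  induction w as [|[] w IH]; simpl; intros Hl H.
  - exists nil, nil, nil; repeat split; try constructor; simpl; tauto.
  - destruct H as [[y [Hy H]] Hw]; destruct IH as [R [C [F [H1 [H2 H3]]]]]; auto; [lia|].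
    apply in_seq in Hy.
    destruct (choose_points (fun x => S (x, y)) L n (a - ncols w)) as [xs [X1 [X2 X3]]].
    { intros t Ht; destruct (H t Ht) as [c [Hc Sc]]; apply in_map_iff in Hc.
      destruct Hc as [x [<- Hx]]; apply in_seq in Hx; eauto. }
    exists (y :: R), C; eexists; split; [|split].
    + apply reach_row with (xs := xs); eauto.
      * intros HR; apply H2 in HR; lia.
      * intros x Hx; destruct (X3 x Hx) as [X4 X5]; split; auto.
        intros HC; apply H3 in HC; nia.
    + intros z [<-|Hz]; [lia | apply H2 in Hz; lia].
    + intros x Hx; apply H3 in Hx; lia.
  - destruct H as [[x [Hx H]] Hw]; destruct IH as [R [C [F [H1 [H2 H3]]]]]; auto; [lia|].
    apply in_seq in Hx.
    destruct (choose_points (fun y => S (x, y)) L m (b - nrows w)) as [ys [X1 [X2 X3]]].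
    { intros t Ht; destruct (H t Ht) as [c [Hc Sc]]; apply in_map_iff in Hc.
      destruct Hc as [y [<- Hy]]; apply in_seq in Hy; eauto. }
    exists R, (x :: C); eexists; split; [|split].
    + apply reach_col with (ys := ys); eauto.
      * intros HR; apply H3 in HR; lia.
      * intros y Hy; destruct (X3 y Hy) as [X4 X5]; split; auto.
        intros HC; apply H2 in HC; nia.
    + intros z Hz; apply H2 in Hz; lia.
    + intros z [<-|Hz]; [lia | apply H3 in Hz; lia].
Qed.

(** The probability that, among [m] independent lines, at least one meets each of its [k] disjoint
    blocks of [n] cells. *)
Definition step_bound (p : R) (n m k : nat) : R := 1 - (1 - (1 - (1 - p) ^ n) ^ k) ^ m.

Lemma hit_bounds (p : R) (n k : nat) :
  0 <= p <= 1 -> 0 <= (1 - (1 - p) ^ n) ^ k <= 1.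
Proof.
  intros Hp.
  assert (H : 0 <= (1 - p) ^ n <= 1).
  { split; [apply pow_le; lra|].
    pose proof (pow_incr (1 - p) 1 n ltac:(lra)) as H; rewrite pow1 in H; exact H. }
  split; [apply pow_le; lra|].
  pose proof (pow_incr (1 - (1 - p) ^ n) 1 k ltac:(lra)) as H1; rewrite pow1 in H1; exact H1.
Qed.

Lemma prob_row_event (p : R) (N M L n m s k : nat) :
  0 <= p <= 1 -> ((L + k) * n <= N)%nat -> (L * m <= M)%nat -> (s < L)%nat ->
  step_bound p n m k <= prob p (box N M) (row_event L n m s k).
Proof.
  intros Hp HN HM Hs; unfold step_bound, row_event.
  rewrite <- (length_seq m (s * m)) at 1.
  apply (prob_some_line p _ _ _ (fun y c => snd c = y)); auto using seq_NoDup.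
  - apply hit_bounds; auto.
  - intros; congruence.
  - intros y Hy; apply in_seq in Hy; split.
    + intros S T HST H t Ht; destruct (H t Ht) as [c [H1 H2]]; exists c; split; auto.
      apply HST; auto; apply in_map_iff in H1; destruct H1 as [x [<- _]]; auto.
    + apply prob_hits_all; auto using NoDup_box; intros t Ht; repeat split.
      * apply NoDup_map_inj; [congruence | apply seq_NoDup].
      * intros c Hc; apply in_map_iff in Hc; destruct Hc as [x [<- Hx]].
        apply in_seq in Hx; apply in_box; simpl; nia.
      * rewrite length_map, length_seq; auto.
Qed.

Lemma prob_col_event (p : R) (N M L n m s k : nat) :
  0 <= p <= 1 -> (L * n <= N)%nat -> ((L + k) * m <= M)%nat -> (s < L)%nat ->
  step_bound p m n k <= prob p (box N M) (col_event L n m s k).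
Proof.
  intros Hp HN HM Hs; unfold step_bound, col_event.
  rewrite <- (length_seq n (s * n)) at 1.
  apply (prob_some_line p _ _ _ (fun y c => fst c = y)); auto using seq_NoDup.
  - apply hit_bounds; auto.
  - intros; congruence.
  - intros x Hx; apply in_seq in Hx; split.
    + intros S T HST H t Ht; destruct (H t Ht) as [c [H1 H2]]; exists c; split; auto.
      apply HST; auto; apply in_map_iff in H1; destruct H1 as [y [<- _]]; auto.
    + apply prob_hits_all; auto using NoDup_box; intros t Ht; repeat split.
      * apply NoDup_map_inj; [congruence | apply seq_NoDup].
      * intros c Hc; apply in_map_iff in Hc; destruct Hc as [y [<- Hy]].
        apply in_seq in Hy; apply in_box; simpl; nia.
      * rewrite length_map, length_seq; auto.
Qed.

Fixpoint path_bound (a b n m : nat) (p : R) (w : list bool) : R :=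
  match w with
  | nil => 1
  | true :: w' => step_bound p n m (a - ncols w') * path_bound a b n m p w'
  | false :: w' => step_bound p m n (b - nrows w') * path_bound a b n m p w'
  end.

Lemma step_bound_nonneg (p : R) (n m k : nat) : 0 <= p <= 1 -> 0 <= step_bound p n m k.
Proof.
  intros Hp; unfold step_bound; pose proof (hit_bounds p n k Hp) as H.
  pose proof (pow_incr (1 - (1 - (1 - p) ^ n) ^ k) 1 m ltac:(lra)) as H1.
  rewrite pow1 in H1; lra.
Qed.

Lemma path_bound_nonneg (a b n m : nat) (p : R) (w : list bool) :
  0 <= p <= 1 -> 0 <= path_bound a b n m p w.
Proof.
  intros Hp; induction w as [|[] w IH]; simpl; [lra| |];
    apply Rmult_le_pos; auto using step_bound_nonneg.
Qed.

(** All step events are increasing, so their joint probability is at least the product by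
    [prob_harris]. *)
Lemma prob_path_event (p : R) (a b N M L n m : nat) (w : list bool) :
  0 <= p <= 1 -> ((L + a) * n <= N)%nat -> ((L + b) * m <= M)%nat -> (length w <= L)%nat ->
  path_bound a b n m p w <= prob p (box N M) (path_event a b L n m w).
Proof.
  intros Hp HN HM; induction w as [|[] w IH]; simpl; intros Hl.
  - rewrite prob_true; [lra | auto].
  - eapply Rle_trans; [|apply prob_harris; auto using row_event_up, path_event_up].
    apply Rmult_le_compat; auto using step_bound_nonneg, path_bound_nonneg.
    + apply prob_row_event; auto; nia.
    + apply IH; lia.
  - eapply Rle_trans; [|apply prob_harris; auto using col_event_up, path_event_up].
    apply Rmult_le_compat; auto using step_bound_nonneg, path_bound_nonneg.
    + apply prob_col_event; auto; nia.
    + apply IH; lia.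
Qed.

Lemma P_span_lower (p : R) (a b N M n m : nat) (w : list bool) :
  0 <= p <= 1 -> (a <= ncols w \/ b <= nrows w)%nat ->
  ((length w + a) * n <= N)%nat -> ((length w + b) * m <= M)%nat ->
  path_bound a b n m p w <= P_span a b N M p.
Proof.
  intros Hp Hw HN HM; rewrite P_span_prob.
  eapply Rle_trans; [apply (prob_path_event p a b N M (length w)); auto|].
  apply prob_le; auto; intros S _ H.
  destruct (path_event_reach a b (length w) n m w S) as [R [C [F [Hr _]]]]; auto.
  eapply reach_spans; eauto.
Qed.

(** * Asymptotics *)

Definition near0 (Q : R -> Prop) : Prop :=
  exists delta, 0 < delta /\ forall p, 0 < p < delta -> Q p.

Lemma near0_and (P Q : R -> Prop) : near0 P -> near0 Q -> near0 (fun p => P p /\ Q p).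
Proof.
  intros [d [Hd HP]] [d' [Hd' HQ]]; exists (Rmin d d'); split; [apply Rmin_pos; auto|].
  intros p Hp; pose proof (Rmin_l d d'); pose proof (Rmin_r d d').
  split; [apply HP | apply HQ]; lra.
Qed.

Lemma near0_impl (P Q : R -> Prop) : (forall p, P p -> Q p) -> near0 P -> near0 Q.
Proof. intros H [d [Hd HP]]; exists d; auto. Qed.

Lemma near0_ln (K : R) : near0 (fun p => 0 < p < 1 /\ ln p < 0 /\ K <= - ln p).
Proof.
  exists (Rmin 1 (exp (- K))); split; [apply Rmin_pos; [lra | apply exp_pos]|].
  intros p Hp; pose proof (Rmin_l 1 (exp (- K))); pose proof (Rmin_r 1 (exp (- K))).
  assert (H1 : ln p < ln 1) by (apply ln_increasing; lra); rewrite ln_1 in H1.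
  assert (H2 : ln p < ln (exp (- K))) by (apply ln_increasing; lra); rewrite ln_exp in H2.
  repeat split; lra.
Qed.

Lemma exp_le (x y : R) : x <= y -> exp x <= exp y.
Proof. intros [H| ->]; [left; apply exp_increasing; auto | right; auto]. Qed.

Lemma pow_exp (x : R) (k : nat) : 0 < x -> x ^ k = exp (INR k * ln x).
Proof. intros Hx; rewrite <- Rpower_pow by auto; reflexivity. Qed.

(** For [p < 1], [n] lies between the powers [-(x - e)] and [-(x + e)] of [p]. The bound
    [1 <= INR n] excludes [n = 0], where [ln] takes a default value. *)
Definition scaled (e x p : R) (n : nat) : Prop :=
  1 <= INR n /\ (x - e) * - ln p <= ln (INR n) <= (x + e) * - ln p.

Lemma scaled_near0 (N : R -> nat) (x e : R) :
  tends_infty0 N -> lim0 (fun p => ln (INR (N p)) / (- ln p)) x -> 0 < e ->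
  near0 (fun p => scaled e x p (N p)).
Proof.
  intros HN Hlim He.
  apply (near0_impl (fun p => (1 <= INR (N p) /\
      Rabs (ln (INR (N p)) / (- ln p) - x) < e) /\ (0 < p < 1 /\ ln p < 0 /\ 0 <= - ln p))).
  - intros p [[H1 H2] [_ [H3 _]]]; split; auto.
    apply Rabs_def2 in H2; destruct H2 as [H2 H2'].
    assert (Hq : ln (INR (N p)) = ln (INR (N p)) / (- ln p) * (- ln p)) by (field; lra).
    set (q := ln (INR (N p)) / - ln p) in *; rewrite Hq; nra.
  - apply near0_and; [apply near0_and; [apply HN | apply Hlim; auto] | apply near0_ln].
Qed.

(** * Exponent of the upper bound *)

Lemma step_weight_le (e alpha beta p : R) (N M k : nat) :
  0 < p < 1 -> scaled e alpha p N -> scaled e beta p M ->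
  INR M * (INR N * p) ^ k <= exp (ln p * (INR k * (1 - alpha) - beta - (INR k + 1) * e)).
Proof.
  intros Hp [N1 [_ N2]] [M1 [_ M2]].
  rewrite pow_exp, ln_mult by nra.
  rewrite <- (exp_ln (INR M)) at 1 by lra; rewrite <- exp_plus; apply exp_le.
  pose proof (Rmult_le_compat_l (INR k) _ _ (pos_INR k) N2); lra.
Qed.

(** The exponent of [p] in [weight]. Steps with many choices contribute negatively here, which is
    why paths have to be stopped before such steps. *)
Fixpoint cost (alpha beta : R) (a b : nat) (w : list bool) : R :=
  match w with
  | nil => 0
  | true :: w' => INR (a - ncols w') * (1 - alpha) - beta + cost alpha beta a b w'
  | false :: w' => INR (b - nrows w') * (1 - beta) - alpha + cost alpha beta a b w'
  end.

Lemma weight_le (e alpha beta p : R) (a b N M : nat) (w : list bool) :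
  0 < e -> 0 < p < 1 -> ln p < 0 -> scaled e alpha p N -> scaled e beta p M ->
  weight a b N M p w <=
  exp (ln p * (cost alpha beta a b w - INR (length w) * (INR (a + b) + 1) * e)).
Proof.
  intros He Hp Hlp HN HM; induction w as [|c w IH]; simpl length.
  - simpl; rewrite Rmult_0_l, Rmult_0_l, Rminus_0_r, Rmult_0_r, exp_0; lra.
  - assert (Hpos : 0 <= weight a b N M p w).
    { destruct HN as [HN _], HM as [HM _]; clear - HN HM Hp.
      induction w as [|[] w IH]; simpl; [lra| |]; repeat apply Rmult_le_pos; auto;
        try lra; apply pow_le; nra. }
    rewrite S_INR; destruct c; simpl.
    + eapply Rle_trans; [apply Rmult_le_compat; [| auto | | exact IH]|].
      * apply Rmult_le_pos; [apply pos_INR | apply pow_le].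
        apply Rmult_le_pos; [apply pos_INR | lra].
      * apply (step_weight_le e alpha beta); auto.
      * rewrite <- exp_plus; apply exp_le.
        assert (H : INR (a - ncols w) <= INR (a + b)) by (apply le_INR; lia).
        assert (H' : INR (a - ncols w) * e <= INR (a + b) * e) by nra.
        nra.
    + eapply Rle_trans; [apply Rmult_le_compat; [| auto | | exact IH]|].
      * apply Rmult_le_pos; [apply pos_INR | apply pow_le].
        apply Rmult_le_pos; [apply pos_INR | lra].
      * apply (step_weight_le e beta alpha); auto.
      * rewrite <- exp_plus; apply exp_le.
        assert (H : INR (b - nrows w) <= INR (a + b)) by (apply le_INR; lia).
        assert (H' : INR (b - nrows w) * e <= INR (a + b) * e) by nra.
        nra.
Qed.

Lemma upper_rate (alpha beta v : R) (a b A' B' : nat) (N M : R -> nat) (eps : R) :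
  (A' <= a)%nat -> (B' <= b)%nat ->
  (forall w, valid A' B' w -> (A' <= ncols w \/ B' <= nrows w)%nat ->
     v <= cost alpha beta a b w) ->
  tends_infty0 N -> tends_infty0 M ->
  lim0 (fun p => ln (INR (N p)) / (- ln p)) alpha ->
  lim0 (fun p => ln (INR (M p)) / (- ln p)) beta -> 0 < eps ->
  near0 (fun p => P_span a b (N p) (M p) p <= exp (ln p * (v - eps))).
Proof.
  intros HA HB Hv HN HM LN LM Heps.
  (* At most [a + b] steps lose [(INR (a + b) + 1) * e] each in the exponent, and the number [c] of
     paths is absorbed by one further [e]; in total [K * e = eps]. *)
  set (K := INR (a + b) * (INR (a + b) + 1) + 1).
  pose proof (pos_INR (a + b)) as Hab.
  assert (HK : 0 < K) by (unfold K; nra).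
  set (e := eps / K).
  assert (He : 0 < e) by (apply Rdiv_lt_0_compat; auto).
  assert (HeK : K * e = eps) by (unfold e; field; lra).
  set (c := INR (length (paths (A' + B')))).
  assert (Hc : 0 < c).
  { apply lt_0_INR; pose proof (in_paths (A' + B') nil (Nat.le_0_l _)) as H.
    destruct (paths (A' + B')); simpl in *; [tauto | lia]. }
  apply (near0_impl (fun p => (scaled e alpha p (N p) /\ scaled e beta p (M p)) /\
           (0 < p < 1 /\ ln p < 0 /\ ln c / e <= - ln p))).
  2: { apply near0_and; [apply near0_and; apply scaled_near0; auto | apply near0_ln]. }
  intros p [[SN SM] [Hp [Hlp Hcl]]].
  eapply Rle_trans.
  - apply (P_span_upper a b A' B' _ _ p (exp (ln p * (v - (K - 1) * e)))); auto; try lra.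
    + left; apply exp_pos.
    + intros w Hw Ht; eapply Rle_trans; [apply (weight_le e alpha beta); auto|].
      apply exp_le.
      assert (Hl : INR (length w) <= INR (a + b)).
      { apply le_INR; rewrite length_path; apply valid_bound in Hw; lia. }
      specialize (Hv w Hw Ht).
      assert (H : INR (length w) * (INR (a + b) + 1) * e <= (K - 1) * e).
      { apply Rmult_le_compat_r; [lra|]; unfold K; nra. }
      nra.
  - fold c; rewrite <- (exp_ln c) by auto; rewrite <- exp_plus; apply exp_le.
    assert (H : ln c <= e * - ln p).
    { apply Rmult_le_compat_l with (r := e) in Hcl; [|lra].
      replace (e * (ln c / e)) with (ln c) in Hcl by (field; lra); exact Hcl. }
    nra.
Qed.

(** * Exponent of the lower bound *)

Lemma one_minus_pow_ge (q y : R) (m : nat) :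
  0 <= q <= 1 -> 0 <= y <= 1 -> y <= INR m * q -> y / 2 <= 1 - (1 - q) ^ m.
Proof.
  intros Hq Hy Hm.
  assert (H0 : forall j, 0 <= (1 - q) ^ j) by (intros j; apply pow_le; lra).
  (* This yields [(1 - q) ^ m <= / (1 + y)], which is at most [1 - y / 2] for [y] in the unit
     interval. *)
  assert (H : (1 - q) ^ m * (1 + INR m * q) <= 1).
  { clear - Hq H0; induction m as [|m IH]; [simpl; lra|].
    rewrite S_INR; simpl pow; specialize (H0 m); pose proof (pos_INR m).
    assert (0 <= (1 - q) ^ m * ((INR m + 1) * (q * q))).
    { apply Rmult_le_pos; auto; apply Rmult_le_pos; nra. }
    nra. }
  specialize (H0 m).
  assert (H1 : (1 - q) ^ m * (1 + y) <= 1) by nra.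
  assert (H2 : 1 <= (1 - y / 2) * (1 + y)) by nra.
  assert (H3 : (1 - q) ^ m <= 1 - y / 2) by (apply Rmult_le_reg_r with (1 + y); lra).
  lra.
Qed.

(** [one_minus_pow_ge] is applied twice: to the [n] cells of a block, with success probability [p],
    and to the [m] lines, with success probability [u ^ k]. The constants [2 * D] and 2 are absorbed
    by the power [e] of [p]. The cut-off at 0 in the exponent is the requirement that [y] be at most
    1. *)
Lemma step_bound_ge (e alpha beta p D : R) (N M n m k : nat) :
  0 < p < 1 -> ln p < 0 -> 0 < e -> 0 <= 1 - alpha - e -> 1 <= D ->
  ln (4 * D) <= e * - ln p ->
  scaled e alpha p N -> scaled e beta p M ->
  (n <= N)%nat -> INR N <= 2 * D * INR n -> INR M <= 2 * D * INR m ->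
  exp (ln p * (Rmax 0 (INR k * (1 - alpha) - beta) + (2 * INR k + 3) * e)) <=
  step_bound p n m k.
Proof.
  intros Hp Hlp He Ha HD Hl [N1 [N2 N3]] [M1 [M2 M3]] HnN Hn Hm.
  pose proof (le_INR _ _ HnN) as HnN'.
  assert (Hn0 : 0 < INR n) by (destruct n; [simpl in *; lra | apply lt_0_INR; lia]).
  assert (Hm0 : 0 < INR m) by (destruct m; [simpl in *; lra | apply lt_0_INR; lia]).
  assert (HeD : exp (e * ln p) <= / (4 * D)).
  { rewrite <- (exp_ln (/ (4 * D))) by (apply Rinv_0_lt_compat; lra).
    apply exp_le; rewrite ln_Rinv by lra; lra. }
  assert (HD4 : 4 * D * / (4 * D) = 1) by (field; lra).
  pose proof (exp_pos (e * ln p)) as Hexp0.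
  assert (Hcmp : forall (x : nat), exp (e * ln p) * (4 * D * INR x) <= INR x).
  { intros x; pose proof (pos_INR x).
    assert (exp (e * ln p) * (4 * D) <= 1).
    { apply Rmult_le_compat_r with (r := 4 * D) in HeD; lra. }
    nra. }
  assert (HNp : INR N * p = exp (ln (INR N) + ln p)) by (rewrite exp_plus, !exp_ln; lra).
  set (u := 1 - (1 - p) ^ n).
  assert (Hu : exp (ln p * (1 - alpha + 2 * e)) <= u).
  { apply Rle_trans with (INR n * p / 2).
    - apply Rle_trans with (exp (e * ln p) * (INR N * p)).
      + rewrite HNp, <- exp_plus; apply exp_le; nra.
      + specialize (Hcmp n).
        assert (exp (e * ln p) * INR N <= INR n / 2).
        { apply Rmult_le_compat_l with (r := exp (e * ln p)) in Hn; lra. }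
        nra.
    - apply one_minus_pow_ge; try lra; split; [nra|].
      apply Rle_trans with (INR N * p); [nra|].
      rewrite HNp, <- exp_0; apply exp_le; nra. }
  assert (Huk : exp (ln p * (INR k * (1 - alpha + 2 * e))) <= u ^ k).
  { eapply Rle_trans; [|apply pow_incr; split; [left; apply exp_pos | exact Hu]].
    rewrite pow_exp by apply exp_pos; rewrite ln_exp; apply exp_le; lra. }
  assert (HmM : exp (ln p * (- beta + 2 * e)) <= INR m).
  { apply Rle_trans with (exp (e * ln p) * INR M).
    - rewrite <- (exp_ln (INR M)) by lra; rewrite <- exp_plus; apply exp_le; nra.
    - specialize (Hcmp m).
      apply Rmult_le_compat_l with (r := exp (e * ln p)) in Hm; lra. }
  set (z := Rmax 0 (INR k * (1 - alpha) - beta)).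
  pose proof (Rmax_l 0 (INR k * (1 - alpha) - beta)) as Hz0; fold z in Hz0.
  pose proof (Rmax_r 0 (INR k * (1 - alpha) - beta)) as Hz1; fold z in Hz1.
  pose proof (pos_INR k) as Hk0.
  set (y := exp (ln p * (z + (2 * INR k + 2) * e))).
  apply Rle_trans with (y / 2).
  - unfold y; apply Rle_trans with (exp (e * ln p) * exp (ln p * (z + (2 * INR k + 2) * e))).
    + rewrite <- exp_plus; apply exp_le; lra.
    + pose proof (exp_pos (ln p * (z + (2 * INR k + 2) * e))).
      assert (/ (4 * D) <= / 2) by (apply Rinv_le_contravar; lra).
      nra.
  - apply one_minus_pow_ge.
    + apply hit_bounds; lra.
    + split; [left; apply exp_pos|]; unfold y; rewrite <- exp_0; apply exp_le.
      assert (0 <= (2 * INR k + 2) * e) by nra; nra.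
    + fold u; apply Rle_trans with
        (exp (ln p * (- beta + 2 * e)) * exp (ln p * (INR k * (1 - alpha + 2 * e)))).
      * rewrite <- exp_plus; apply exp_le; nra.
      * apply Rmult_le_compat; auto; left; apply exp_pos.
Qed.

(** A step with an abundance of choices still has probability at most 1, so each step cost is cut
    off at 0, unlike in [cost]. *)
Fixpoint cost_pos (alpha beta : R) (a b : nat) (w : list bool) : R :=
  match w with
  | nil => 0
  | true :: w' =>
      Rmax 0 (INR (a - ncols w') * (1 - alpha) - beta) + cost_pos alpha beta a b w'
  | false :: w' =>
      Rmax 0 (INR (b - nrows w') * (1 - beta) - alpha) + cost_pos alpha beta a b w'
  end.

Lemma path_bound_ge (e alpha beta p D : R) (a b N M n m : nat) (w : list bool) :
  0 < p < 1 -> ln p < 0 -> 0 < e -> 0 <= 1 - alpha - e -> 0 <= 1 - beta - e -> 1 <= D ->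
  ln (4 * D) <= e * - ln p ->
  scaled e alpha p N -> scaled e beta p M ->
  (n <= N)%nat -> (m <= M)%nat -> INR N <= 2 * D * INR n -> INR M <= 2 * D * INR m ->
  exp (ln p * (cost_pos alpha beta a b w + INR (length w) * (2 * INR (a + b) + 3) * e)) <=
  path_bound a b n m p w.
Proof.
  intros Hp Hlp He Ha Hb HD Hl SN SM HnN HmM Hn Hm.
  induction w as [|c w IH]; simpl length.
  - simpl; rewrite Rmult_0_l, Rmult_0_l, Rplus_0_r, Rmult_0_r, exp_0; lra.
  - rewrite S_INR; destruct c; simpl.
    + eapply Rle_trans; [|apply Rmult_le_compat; [| | | exact IH]];
        [| | left; apply exp_pos |
         apply (step_bound_ge e alpha beta p D N M); auto]; [|left; apply exp_pos].
      rewrite <- exp_plus; apply exp_le.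
      assert (H : INR (a - ncols w) <= INR (a + b)) by (apply le_INR; lia).
      assert (H' : INR (a - ncols w) * e <= INR (a + b) * e) by nra.
      nra.
    + eapply Rle_trans; [|apply Rmult_le_compat; [| | | exact IH]];
        [| | left; apply exp_pos |
         apply (step_bound_ge e beta alpha p D M N); auto]; [|left; apply exp_pos].
      rewrite <- exp_plus; apply exp_le.
      assert (H : INR (b - nrows w) <= INR (a + b)) by (apply le_INR; lia).
      assert (H' : INR (b - nrows w) * e <= INR (a + b) * e) by nra.
      nra.
Qed.

(** The quotient is at least 1, so rounding down loses at most a factor 2. *)
Lemma div_lower (N D : nat) : (1 <= D <= N)%nat -> INR N <= 2 * INR D * INR (N / D).
Proof.
  intros H; replace (2 * INR D * INR (N / D)) with (INR (2 * D * (N / D)))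
    by (rewrite !mult_INR; simpl (INR 2); ring).
  apply le_INR; pose proof (Nat.div_mod_eq N D); pose proof (Nat.mod_upper_bound N D).
  assert (1 <= N / D)%nat by (apply Nat.div_le_lower_bound; lia); nia.
Qed.

Lemma lower_rate (alpha beta : R) (a b : nat) (w : list bool) (N M : R -> nat) (eps : R) :
  (1 <= a)%nat -> alpha < 1 -> beta < 1 ->
  (a <= ncols w \/ b <= nrows w)%nat ->
  tends_infty0 N -> tends_infty0 M ->
  lim0 (fun p => ln (INR (N p)) / (- ln p)) alpha ->
  lim0 (fun p => ln (INR (M p)) / (- ln p)) beta -> 0 < eps ->
  near0 (fun p => exp (ln p * (cost_pos alpha beta a b w + eps)) <=
                  P_span a b (N p) (M p) p).
Proof.
  intros Ha1 Ha Hb Hw HN HM LN LM Heps.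
  set (K := INR (length w) * (2 * INR (a + b) + 3) + 1).
  pose proof (pos_INR (a + b)) as Hab; pose proof (pos_INR (length w)) as Hlw.
  assert (HK : 0 < K) by (unfold K; nra).
  (* Besides keeping the total error below [eps], [e] must leave [1 - alpha - e] and [1 - beta - e]
     nonnegative, as [step_bound_ge] requires in either direction. *)
  set (e := Rmin (eps / K) (Rmin (1 - alpha) (1 - beta))).
  assert (He : 0 < e).
  { apply Rmin_pos; [apply Rdiv_lt_0_compat; auto | apply Rmin_pos; lra]. }
  assert (HeK : K * e <= eps).
  { replace eps with (K * (eps / K)) by (field; lra).
    apply Rmult_le_compat_l; [lra | apply Rmin_l]. }
  assert (Hea : e <= 1 - alpha /\ e <= 1 - beta).
  { pose proof (Rmin_r (eps / K) (Rmin (1 - alpha) (1 - beta))) as H; fold e in H.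
    pose proof (Rmin_l (1 - alpha) (1 - beta)); pose proof (Rmin_r (1 - alpha) (1 - beta)).
    lra. }
  (* The box is cut into [D] strips each way: [length w] of them supply the lines and up to [a] or
     [b] more supply the points. *)
  set (D := (length w + a + b)%nat).
  assert (HD : (1 <= D)%nat) by (unfold D; lia).
  apply (near0_impl (fun p => ((scaled e alpha p (N p) /\ scaled e beta p (M p)) /\
           (INR D <= INR (N p) /\ INR D <= INR (M p))) /\
           (0 < p < 1 /\ ln p < 0 /\ ln (4 * INR D) / e <= - ln p))).
  2: { apply near0_and; [apply near0_and; apply near0_and | apply near0_ln];
         [apply scaled_near0; auto | apply scaled_near0; auto | apply HN | apply HM]. }
  intros p [[[SN SM] [DN DM]] [Hp [Hlp Hcl]]].
  apply INR_le in DN; apply INR_le in DM.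
  pose proof (Nat.Div0.mul_div_le (N p) D) as QN.
  pose proof (Nat.Div0.mul_div_le (M p) D) as QM.
  eapply Rle_trans; [|apply (P_span_lower p a b (N p) (M p) (N p / D) (M p / D) w)]; auto;
    try lra; try (unfold D in *; nia).
  eapply Rle_trans; [|apply (path_bound_ge e alpha beta p (INR D) a b (N p) (M p))];
    auto using div_lower; try lra; try nia.
  - apply exp_le; fold K; unfold K in HeK; nra.
  - apply (le_INR 1); auto.
  - apply Rmult_le_compat_l with (r := e) in Hcl; [|lra].
    replace (e * (ln (4 * INR D) / e)) with (ln (4 * INR D)) in Hcl by (field; lra); exact Hcl.
Qed.

Lemma has_rate_of_bounds (alpha beta v : R) (a b : nat) :
  (forall (N M : R -> nat) eps,
     tends_infty0 N -> tends_infty0 M ->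
     lim0 (fun p => ln (INR (N p)) / (- ln p)) alpha ->
     lim0 (fun p => ln (INR (M p)) / (- ln p)) beta -> 0 < eps ->
     near0 (fun p => exp (ln p * (v + eps)) <= P_span a b (N p) (M p) p) /\
     near0 (fun p => P_span a b (N p) (M p) p <= exp (ln p * (v - eps)))) ->
  has_rate alpha beta a b v.
Proof.
  intros H N M HN HM LN LM; split.
  - destruct (H N M 1) as [H1 _]; auto; try lra.
    destruct H1 as [d [Hd H1]]; exists d; split; auto; intros p Hp.
    eapply Rlt_le_trans; [apply exp_pos | apply H1; auto].
  (* Half of [eps] turns the weak bounds on the exponent into the strict inequality of [lim0]. *)
  - intros eps Heps; destruct (H N M (eps / 2)) as [H1 H2]; auto; try lra.
    assert (H3 := near0_and _ _ (near0_and _ _ H1 H2) (near0_ln 0)).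
    revert H3; apply near0_impl; intros p [[H3 H4] [Hp [Hlp _]]].
    set (P := P_span a b (N p) (M p) p) in *.
    assert (HP : 0 < P) by (eapply Rlt_le_trans; [apply exp_pos | exact H3]).
    rewrite <- (exp_ln P) in H3, H4 by auto.
    assert (H5 : ln p * (v + eps / 2) <= ln P).
    { apply Rnot_lt_le; intros Hlt; apply exp_increasing in Hlt; lra. }
    assert (H6 : ln P <= ln p * (v - eps / 2)).
    { apply Rnot_lt_le; intros Hlt; apply exp_increasing in Hlt; lra. }
    assert (Hq : ln P = ln P / ln p * ln p) by (field; lra).
    set (q := ln P / ln p) in *; rewrite Hq in H5, H6.
    apply Rabs_def1; nra.
Qed.

(** * Optimal paths *)

Lemma ncols_rows (n : nat) (w : list bool) : ncols (repeat true n ++ w) = ncols w.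
Proof. induction n; simpl; auto. Qed.

Lemma ncols_cols (n : nat) (w : list bool) :
  ncols (repeat false n ++ w) = (n + ncols w)%nat.
Proof. induction n; simpl; auto. Qed.

Lemma nrows_cols (n : nat) (w : list bool) : nrows (repeat false n ++ w) = nrows w.
Proof. induction n; simpl; auto. Qed.

Lemma nrows_rows (n : nat) (w : list bool) :
  nrows (repeat true n ++ w) = (n + nrows w)%nat.
Proof. induction n; simpl; auto. Qed.

Lemma cost_pos_rows (alpha beta : R) (a b n : nat) (w : list bool) :
  cost_pos alpha beta a b (repeat true n ++ w) =
  INR n * Rmax 0 (INR (a - ncols w) * (1 - alpha) - beta) + cost_pos alpha beta a b w.
Proof.
  induction n as [|n IH]; [simpl; ring|].
  rewrite S_INR; simpl; rewrite IH, ncols_rows; ring.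
Qed.

Lemma cost_pos_cols (alpha beta : R) (a b n : nat) (w : list bool) :
  cost_pos alpha beta a b (repeat false n ++ w) =
  INR n * Rmax 0 (INR (b - nrows w) * (1 - beta) - alpha) + cost_pos alpha beta a b w.
Proof.
  induction n as [|n IH]; [simpl; ring|].
  rewrite S_INR; simpl; rewrite IH, nrows_cols; ring.
Qed.

(* The left-hand side is the cost of filling all rows before all columns. *)
Lemma cost_ge_rows_first (alpha beta : R) (a b A' B' : nat) (w : list bool) :
  (A' <= a)%nat -> (B' <= b)%nat -> beta <= alpha -> valid A' B' w ->
  INR (nrows w) * (INR a * (1 - alpha) - beta) +
  INR (ncols w) * ((INR b - INR (nrows w)) * (1 - beta) - alpha) <= cost alpha beta a b w.
Proof.
  intros HA HB Hab; induction w as [|c w IH]; simpl valid; intros Hv.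
  - simpl; lra.
  - destruct Hv as [V1 [V2 V3]]; specialize (IH V3).
    pose proof (pos_INR (ncols w)) as P1.
    (* A column step raises the left-hand side by exactly its cost; a row step raises it by its cost
       minus [INR (ncols w) * (alpha - beta)]. *)
    destruct c; simpl nrows; simpl ncols; rewrite S_INR; simpl cost;
      rewrite minus_INR by lia; nra.
Qed.

Lemma cost_lower_bound (alpha beta v : R) (a b da db : nat) :
  alpha < 1 -> beta < 1 -> 0 <= beta -> beta <= alpha ->
  (da < a)%nat -> (db < b)%nat -> INR da * (1 - alpha) <= beta ->
  v <= (INR b - INR db) * (INR a * (1 - alpha) - beta) ->
  v <= (INR b - INR db) * (INR a * (1 - alpha) - beta) +
       (INR a - INR da - 1) * (INR db * (1 - beta) - beta) ->
  v <= (INR b - INR db - 1) * (INR a * (1 - alpha) - beta) +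
       (INR a - INR da) * ((INR db + 1) * (1 - beta) - alpha) ->
  forall w, valid (a - da) (b - db) w ->
    (a - da <= ncols w \/ b - db <= nrows w)%nat -> v <= cost alpha beta a b w.
Proof.
  intros Ha Hb Hb0 Hab Hda Hdb Hda1 HX HY' HY w Hv Ht.
  assert (Ha1 : INR da + 1 <= INR a) by (rewrite <- S_INR; apply le_INR; lia).
  pose proof (pos_INR da) as Hda0.
  destruct w as [|c w]; [simpl in Ht; lia|].
  pose proof (cost_ge_rows_first alpha beta a b (a - da) (b - db) (c :: w)
                ltac:(lia) ltac:(lia) Hab Hv) as G.
  destruct Hv as [V1 [V2 V3]].
  pose proof (cost_ge_rows_first alpha beta a b (a - da) (b - db) w
                ltac:(lia) ltac:(lia) Hab V3) as G'.
  destruct (Nat.le_gt_cases (b - db) (nrows (c :: w))) as [Hr|Hr].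
  - destruct c; simpl nrows in Hr; [|lia].
    simpl cost; rewrite minus_INR by lia.
    assert (Hn : INR (nrows w) = INR b - INR db - 1).
    { replace (nrows w) with (b - db - 1)%nat by lia.
      rewrite !minus_INR by lia; reflexivity. }
    rewrite Hn in G'.
    assert (Hi : INR (ncols w) <= INR a - INR da - 1).
    { apply le_INR in V1; rewrite S_INR, minus_INR in V1 by lia; lra. }
    pose proof (pos_INR (ncols w)) as Hi0.
    (* The path ends with a row. Its bound is affine in [INR (ncols w)] with slope
       [INR db * (1 - beta) - beta]: the value 0 gives the first hypothesis on [v], the value
       [INR a - INR da - 1] the second. *)
    destruct (Rle_lt_dec 0 (INR db * (1 - beta) - beta)); nra.
  - assert (Hn : INR (ncols (c :: w)) = INR a - INR da).
    { rewrite <- minus_INR by lia; f_equal.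
      destruct c; simpl ncols in *; simpl nrows in *; lia. }
    rewrite Hn in G.
    assert (Hj : INR (nrows (c :: w)) <= INR b - INR db - 1).
    { apply le_INR in Hr; rewrite S_INR, minus_INR in Hr by lia; lra. }
    set (j := INR (nrows (c :: w))) in *.
    (* the bound [G] is nonincreasing in the number [j] of rows *)
    assert (Hs : INR a * (1 - alpha) - beta - (INR a - INR da) * (1 - beta) <= 0) by nra.
    nra.
Qed.

Lemma floorR_nat (x : R) : 0 <= x -> exists n, floorR x = INR n /\ INR n <= x < INR n + 1.
Proof.
  intros Hx; destruct (base_Int_part x) as [H1 H2].
  assert (Hz : (0 <= Int_part x)%Z).
  { apply Z.lt_succ_r, lt_IZR; rewrite succ_IZR; lra. }
  exists (Z.to_nat (Int_part x)).
  assert (Hn : INR (Z.to_nat (Int_part x)) = IZR (Int_part x))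
    by (rewrite INR_IZR_INZ, Z2Nat.id; auto).
  unfold floorR; rewrite Hn; repeat split; lra.
Qed.

Lemma near0_span_ge (alpha beta v : R) (a b : nat) (w : list bool) (N M : R -> nat) (eps : R) :
  (1 <= a)%nat -> alpha < 1 -> beta < 1 ->
  (a <= ncols w \/ b <= nrows w)%nat -> cost_pos alpha beta a b w <= v ->
  tends_infty0 N -> tends_infty0 M ->
  lim0 (fun p => ln (INR (N p)) / (- ln p)) alpha ->
  lim0 (fun p => ln (INR (M p)) / (- ln p)) beta -> 0 < eps ->
  near0 (fun p => exp (ln p * (v + eps)) <= P_span a b (N p) (M p) p).
Proof.
  intros Ha1 Ha Hb Hw Hv HN HM LN LM Heps.
  generalize (near0_and _ _ (lower_rate alpha beta a b w N M eps Ha1 Ha Hb Hw HN HM LN LM Heps)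
                (near0_ln 0)).
  apply near0_impl; intros p [H [_ [Hl _]]].
  eapply Rle_trans; [apply exp_le | exact H]; nra.
Qed.

Lemma has_rate_zero (alpha beta : R) (a b : nat) (w : list bool) :
  (1 <= a)%nat -> alpha < 1 -> beta < 1 ->
  (a <= ncols w \/ b <= nrows w)%nat -> cost_pos alpha beta a b w <= 0 ->
  has_rate alpha beta a b 0.
Proof.
  intros Ha1 Ha Hb Hw Hc; apply has_rate_of_bounds.
  intros N M eps HN HM LN LM Heps; split.
  - apply (near0_span_ge alpha beta _ a b w); auto.
  - generalize (near0_ln 0); apply near0_impl; intros p [Hp [Hl _]].
    rewrite P_span_prob; apply Rle_trans with 1; [apply prob_le_1; lra|].
    rewrite <- exp_0; apply exp_le; nra.
Qed.

(** The path [w] runs until the plane fills, while costs are bounded below only up to the thresholds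
    [A'] and [B']. The two bounds meet when the remaining steps of [w] are free. *)
Lemma has_rate_path (alpha beta v : R) (a b A' B' : nat) (w : list bool) :
  (1 <= a)%nat -> alpha < 1 -> beta < 1 -> (A' <= a)%nat -> (B' <= b)%nat ->
  (a <= ncols w \/ b <= nrows w)%nat -> cost_pos alpha beta a b w <= v ->
  (forall w', valid A' B' w' -> (A' <= ncols w' \/ B' <= nrows w')%nat ->
     v <= cost alpha beta a b w') ->
  has_rate alpha beta a b v.
Proof.
  intros Ha1 Ha Hb HA HB Hw Hc Hv; apply has_rate_of_bounds.
  intros N M eps HN HM LN LM Heps; split.
  - apply (near0_span_ge alpha beta _ a b w); auto.
  - apply (upper_rate alpha beta _ a b A' B'); auto.
Qed.

Lemma has_rate_swap (alpha beta v : R) (a b : nat) :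
  has_rate alpha beta a b v -> has_rate beta alpha b a v.
Proof.
  intros H N M HN HM LN LM; specialize (H M N HM HN LM LN).
  assert (E : forall p, P_span b a (N p) (M p) p = P_span a b (M p) (N p) p)
    by (intros; apply P_span_swap).
  destruct H as [[d [Hd H1]] H2]; split.
  - exists d; split; auto; intros p Hp; rewrite E; auto.
  - intros eps Heps; destruct (H2 eps Heps) as [d' [Hd' H3]]; exists d'; split; auto.
    intros p Hp; rewrite E; auto.
Qed.

Theorem mainTheorem10 (a b : nat) (alpha beta : R) :
  (1 <= a)%nat -> (1 <= b)%nat ->
  0 <= alpha < 1 -> 0 <= beta < 1 ->
  let Da := floorR (beta / (1 - alpha)) in
  let Db := floorR (alpha / (1 - beta)) in
  let A := INR a in
  let B := INR b in
  ((B <= Db \/ A <= Da) -> has_rate alpha beta a b 0) /\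
  (Db < B -> Da < A -> beta <= alpha -> Db * (1 - beta) <= beta ->
     has_rate alpha beta a b
       ((1 - alpha) * A * B + ((alpha - beta) * Db - beta) * A - beta * B
        - (1 - beta) * Da * Db + beta * Da + beta * Db + beta
        - Rmax ((1 - beta) * Db) ((1 - alpha) * Da))) /\
  (Db < B -> Da < A -> beta <= alpha -> Db * (1 - beta) > beta ->
     has_rate alpha beta a b
       ((1 - alpha) * A * B + alpha * Db * A - beta * B + beta * Db
        + Rmin (- beta * (Db + 1) * A - (1 - beta) * Da * Db + beta * Da + beta
                - (1 - alpha) * Da)
               (- Db * A))) /\
  (Db < B -> Da < A -> alpha <= beta ->
     forall v, has_rate alpha beta a b v <-> has_rate beta alpha b a v).
Proof.
  intros Ha1 Hb1 [Ha0 Ha] [Hb0 Hb] Da Db A B.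
  destruct (floorR_nat (beta / (1 - alpha))) as [da [Eda [da1 da2]]].
  { apply Rle_mult_inv_pos; lra. }
  destruct (floorR_nat (alpha / (1 - beta))) as [db [Edb [db1 db2]]].
  { apply Rle_mult_inv_pos; lra. }
  unfold Da, Db; rewrite Eda, Edb; clear Da Db Eda Edb.
  assert (Ea : beta / (1 - alpha) * (1 - alpha) = beta) by (field; lra).
  assert (Eb : alpha / (1 - beta) * (1 - beta) = alpha) by (field; lra).
  (* A row lacking [da] points is free, one lacking [da + 1] has positive cost; [db] plays the same
     role for columns. *)
  assert (da3 : INR da * (1 - alpha) <= beta) by nra.
  assert (da4 : beta < (INR da + 1) * (1 - alpha)) by nra.
  assert (db3 : INR db * (1 - beta) <= alpha) by nra.
  assert (db4 : alpha < (INR db + 1) * (1 - beta)) by nra.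
  clear da1 da2 db1 db2 Ea Eb; unfold A, B; clear A B.
  (* Words are read from the right: [b - db] rows, then [a] columns lacking [db] points each, hence
     free. *)
  assert (HX : (db < b)%nat -> (da < a)%nat ->
    cost_pos alpha beta a b (repeat false a ++ repeat true (b - db) ++ nil) =
    (INR b - INR db) * (INR a * (1 - alpha) - beta)).
  { intros H1 H2; apply lt_INR in H1 as H1'; assert (H2' : INR da + 1 <= INR a)
      by (rewrite <- S_INR; apply le_INR; lia).
    rewrite cost_pos_cols, cost_pos_rows, nrows_rows; simpl ncols; simpl nrows; simpl cost_pos.
    replace (b - (b - db + 0))%nat with db by lia; rewrite Nat.sub_0_r, minus_INR by lia.
    rewrite Rmax_left, Rmax_right by nra; ring. }
  (* The [a - da] columns lack [db + 1] points each; the final [b] rows lack [da] and are free, so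
     having more than [b] rows in total adds no cost. *)
  assert (HY : (db < b)%nat -> (da < a)%nat ->
    cost_pos alpha beta a b
      (repeat true b ++ repeat false (a - da) ++ repeat true (b - db - 1) ++ nil) =
    (INR b - INR db - 1) * (INR a * (1 - alpha) - beta) +
    (INR a - INR da) * ((INR db + 1) * (1 - beta) - alpha)).
  { intros H1 H2; apply lt_INR in H1 as H1'; assert (H2' : INR da + 1 <= INR a)
      by (rewrite <- S_INR; apply le_INR; lia).
    rewrite cost_pos_rows, cost_pos_cols, cost_pos_rows, ncols_cols, ncols_rows, nrows_rows.
    simpl ncols; simpl nrows; simpl cost_pos.
    replace (a - (a - da + 0))%nat with da by lia.
    replace (b - (b - db - 1 + 0))%nat with (S db) by lia.
    rewrite Nat.sub_0_r, !minus_INR, S_INR by lia; simpl (INR 1).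
    rewrite Rmax_left by lra; rewrite !Rmax_right by nra; ring. }
  (* The single row in the middle lacks [da + 1] points; it makes the [a] columns after it free. *)
  assert (HY' : (db < b)%nat -> (da < a)%nat ->
    cost_pos alpha beta a b
      (repeat false a ++ true :: repeat false (a - da - 1) ++ repeat true (b - db - 1) ++ nil) =
    (INR b - INR db) * (INR a * (1 - alpha) - beta) +
    (INR a - INR da - 1) * (INR db * (1 - beta) - beta)).
  { intros H1 H2; apply lt_INR in H1 as H1'; assert (H2' : INR da + 1 <= INR a)
      by (rewrite <- S_INR; apply le_INR; lia).
    rewrite cost_pos_cols; simpl nrows; simpl cost_pos.
    rewrite cost_pos_cols, cost_pos_rows, ncols_cols, ncols_rows, nrows_cols, nrows_rows.
    simpl ncols; simpl nrows; simpl cost_pos.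
    replace (a - (a - da - 1 + 0))%nat with (S da) by lia.
    replace (b - S (b - db - 1 + 0))%nat with db by lia.
    replace (b - (b - db - 1 + 0))%nat with (S db) by lia.
    rewrite Nat.sub_0_r, !minus_INR, !S_INR by lia; change (INR 0) with 0.
    rewrite Rmax_left by lra; rewrite !Rmax_right by nra; ring. }
  split; [|split; [|split]].
  (* If [b <= db], even a column lacking all [b] points is free; similarly for rows if [a <= da]. *)
  - intros [H|H]; apply INR_le in H.
    + apply (has_rate_zero alpha beta a b (repeat false a ++ nil)); auto.
      * left; rewrite ncols_cols; lia.
      * rewrite cost_pos_cols; simpl nrows; simpl cost_pos; apply le_INR in H.
        rewrite Nat.sub_0_r, Rmax_left by nra; lra.
    + apply (has_rate_zero alpha beta a b (repeat true b ++ nil)); auto.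
      * right; rewrite nrows_rows; lia.
      * rewrite cost_pos_rows; simpl ncols; simpl cost_pos; apply le_INR in H.
        rewrite Nat.sub_0_r, Rmax_left by nra; lra.
  - intros H1 H2 H3 H4; apply INR_lt in H1; apply INR_lt in H2.
    specialize (HX H1 H2); specialize (HY H1 H2); specialize (HY' H1 H2).
    assert (H2' : INR da + 1 <= INR a) by (rewrite <- S_INR; apply le_INR; lia).
    (* So the path of [HY'] costs no more than that of [HX]. It costs [(1 - alpha) * INR da - (1 -
       beta) * INR db] more than that of [HY], and the maximum in the formula picks the cheaper of
       the two. *)
    assert (Hs : (INR a - INR da - 1) * (INR db * (1 - beta) - beta) <= 0) by nra.
    destruct (Rle_lt_dec ((1 - beta) * INR db) ((1 - alpha) * INR da)) as [Hm|Hm].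
    + rewrite Rmax_right by lra.
      eapply has_rate_path with (A' := (a - da)%nat) (B' := (b - db)%nat)
        (w := repeat true b ++ repeat false (a - da) ++ repeat true (b - db - 1) ++ nil);
        auto; try lia; [right; rewrite nrows_rows; lia | rewrite HY; lra |].
      apply cost_lower_bound; auto; lra.
    + rewrite Rmax_left by lra.
      eapply has_rate_path with (A' := (a - da)%nat) (B' := (b - db)%nat)
        (w := repeat false a ++ true :: repeat false (a - da - 1) ++
              repeat true (b - db - 1) ++ nil);
        auto; try lia; [left; rewrite ncols_cols; lia | rewrite HY'; lra |].
      apply cost_lower_bound; auto; lra.
  - intros H1 H2 H3 H4; apply INR_lt in H1; apply INR_lt in H2.
    specialize (HX H1 H2); specialize (HY H1 H2); specialize (HY' H1 H2).
    assert (H2' : INR da + 1 <= INR a) by (rewrite <- S_INR; apply le_INR; lia).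
    (* Here [HX] costs no more than [HY']; the two arguments of the minimum correspond to [HY] and
       [HX]. *)
    assert (Hs : 0 <= (INR a - INR da - 1) * (INR db * (1 - beta) - beta)) by nra.
    unfold Rmin; match goal with |- context [Rle_dec ?x ?y] => destruct (Rle_dec x y) as [Hm|Hm] end.
    + eapply has_rate_path with (A' := (a - da)%nat) (B' := (b - db)%nat)
        (w := repeat true b ++ repeat false (a - da) ++ repeat true (b - db - 1) ++ nil);
        auto; try lia; [right; rewrite nrows_rows; lia | rewrite HY; lra |].
      apply cost_lower_bound; auto; lra.
    + eapply has_rate_path with (A' := (a - da)%nat) (B' := (b - db)%nat)
        (w := repeat false a ++ repeat true (b - db) ++ nil);
        auto; try lia; [left; rewrite ncols_cols; lia | rewrite HX; lra |].
      apply cost_lower_bound; auto; lra.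
  - intros _ _ _ v; split; apply has_rate_swap.
Qed.
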